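(* There exists an absolute constant $c>0$ such that for every integer $n\ge 1$ and every family $\mathcal{A}\subset\Omega_n=\{0,1\}^n$ that is increasing, balanced and regular, $$\mathrm{Cov}_\mu(\mathbf{1}_{\mathcal{A}},\mathrm{Maj})\ \ge\ c\,\frac{\log n}{\sqrt n}.$$
   Context: $\Omega_n=\{0,1\}^n$ and $\mu$ is the uniform probability measure on $\Omega_n$. For $u,v:\Omega_n\to\mathbb{R}$, $\mathrm{Cov}_\mu(u,v)=\mathbb{E}_\mu[uv]-\mathbb{E}_\mu[u]\,\mathbb{E}_\mu[v]$. A family $\mathcal{A}\subseteq\Omega_n$ is increasing if $x\in\mathcal{A}$ and $x\le y$ coordinatewise imply $y\in\mathcal{A}$. It is balanced if $\mu(\mathcal{A})=1/2$. The influence of coordinate $k$ on $\mathcal{A}$ is $I_k(\mathcal{A})=2\mu(\{x\in\mathcal{A}: x\oplus e_k\notin\mathcal{A}\})$, where $x\oplus e_k$ is obtained from $x$ by flipping the $k$-th coordinate. $\mathcal{A}$ is regular if $I_1(\mathcal{A})=\dots=I_n(\mathcal{A})$. The majority function is $\mathrm{Maj}(x)=\mathbf{1}_{\{\sum_{i=1}^n x_i>n/2\}}$. $\log$ is the natural logarithm. *)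

(* Defs.v *)
From HB Require Import structures.
From mathcomp Require Import all_boot all_order all_algebra.
From mathcomp Require Import reals exp.

Set Implicit Arguments.
Unset Strict Implicit.
Unset Printing Implicit Defensive.

Import Order.TTheory GRing.Theory Num.Theory.
Local Open Scope ring_scope.

Definition Omega (n : nat) := {ffun 'I_n -> bool}.

Definition flip (n : nat) (k : 'I_n) (x : Omega n) : Omega n :=
  [ffun i => if i == k then ~~ x i else x i].

Definition increasing (n : nat) (A : {set Omega n}) : Prop :=
  forall x y : Omega n, x \in A -> (forall i, x i ==> y i) -> y \in A.

Section UniformMeasure.
Variables (R : realType) (n : nat).

Definition mu (A : {set Omega n}) : R := #|A|%:R / #|{: Omega n}|%:R.

Definition expect (u : Omega n -> R) : R := \sum_x u x * mu [set x].

Definition cov (u v : Omega n -> R) : R :=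
  expect (fun x => u x * v x) - expect u * expect v.

Definition indic (A : {set Omega n}) : Omega n -> R := fun x => (x \in A)%:R.

Definition balanced (A : {set Omega n}) : Prop := mu A = 1 / 2.

Definition influence (k : 'I_n) (A : {set Omega n}) : R :=
  2 * mu [set x in A | flip k x \notin A].

Definition regular (A : {set Omega n}) : Prop :=
  forall j k : 'I_n, influence j A = influence k A.

Definition Maj : Omega n -> R :=
  fun x => (n%:R / 2 < \sum_(i < n) (x i)%:R :> R)%:R.

End UniformMeasure.

Arguments Maj {R n}.

(* Main.v *)
Require Import Defs.
From HB Require Import structures.
From mathcomp Require Import all_boot all_order all_fingroup all_algebra.
From mathcomp Require Import reals exp.
From mathcomp Require Import ring lra zify.

Set Implicit Arguments.
Unset Strict Implicit.
Unset Printing Implicit Defensive.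

Import Order.TTheory GRing.Theory Num.Theory.
Local Open Scope ring_scope.

(** Let [f] be the indicator of the family and [a i] its density on the [i]-th
layer, a nondecreasing sequence with middle value [c0].  The covariance with
majority is at least a quarter of the mean deviation of [a] from [c0], so it is
enough to bound this deviation from below.

Add [n] dummy coordinates and let [alpha], [beta] be the densities of the
extended family [F] on the layers [n] and [n + 1] of the cube of dimension [2n].
Forgetting the dummy coordinates, these layers become measures on the original
cube with bounded density, and differing by [O(1 / sqrt n)] from one another;
hence [beta - alpha] is [O(1 / sqrt n)] times the mean deviation, and it remains
to show [n (beta - alpha) >= c log n].

A uniformly random perfect matching of the [2n] coordinates embeds the cube
[{0,1}^n] in the layer [n]: a point chooses one element of each pair.  The KKL
argument is applied to the restriction of [F] to this random subcube.
- Two independent points of the subcube have a joint law comparable with that of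
  two independent points of the layer, so the variance of the restriction is at
  least [alpha (1 - alpha) / 2] on average.
- Exchanging the two elements of a pair can be done through the layer [n + 1],
  so each influence of the restriction is at most [2 (beta - alpha)] on average.
- The same comparison of laws, truncated, bounds the second moment of these
  random influences by [n ^ (- delta)] times their mean.  Here regularity enters:
  by Parseval on the first level all the influences of [f] are at most
  [2 / sqrt n]. *)

(** * Averages and Fourier analysis on the cube *)

Section Average.
Variables (R : realFieldType).

Definition avg (T : finType) (g : T -> R) : R := (\sum_x g x) / #|T|%:R.

Lemma eq_avg (T : finType) (g h : T -> R) : g =1 h -> avg g = avg h.
Proof. by move=> gh; congr (_ / _); apply: eq_bigr => x _; apply: gh. Qed.

Lemma avgD (T : finType) (g h : T -> R) :
  avg (fun x => g x + h x) = avg g + avg h.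
Proof. by rewrite /avg big_split mulrDl. Qed.

Lemma avgZ (T : finType) (a : R) (g : T -> R) :
  avg (fun x => a * g x) = a * avg g.
Proof. by rewrite /avg -mulr_sumr mulrA. Qed.

Lemma avgB (T : finType) (g h : T -> R) :
  avg (fun x => g x - h x) = avg g - avg h.
Proof. by rewrite /avg sumrB mulrBl. Qed.

Lemma avg_sum (T I : finType) (Q : pred I) (g : I -> T -> R) :
  avg (fun x => \sum_(i | Q i) g i x) = \sum_(i | Q i) avg (g i).
Proof. by rewrite /avg exchange_big /= mulr_suml. Qed.

Lemma exchange_avg (T U : finType) (g : T -> U -> R) :
  avg (fun x => avg (g x)) = avg (fun y => avg (g^~ y)).
Proof.
rewrite /avg -!mulr_suml exchange_big /= -!mulrA; congr (_ * _).
exact: mulrC.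
Qed.

Lemma ler_avg (T : finType) (g h : T -> R) :
  (forall x, g x <= h x) -> avg g <= avg h.
Proof.
move=> gh; rewrite ler_wpM2r ?invr_ge0 ?ler0n //.
by apply: ler_sum => x _; apply: gh.
Qed.

Lemma avg_ge0 (T : finType) (g : T -> R) : (forall x, 0 <= g x) -> 0 <= avg g.
Proof.
by move=> g0; rewrite mulr_ge0 ?invr_ge0 ?ler0n // sumr_ge0 => // x _.
Qed.

Lemma avg_const (T : finType) (a : R) : (0 < #|T|)%N -> avg (fun _ : T => a) = a.
Proof.
by move=> T0; rewrite /avg sumr_const -[a *+ _]mulr_natr -mulrA divff ?mulr1 ?pnatr_eq0 -?lt0n.
Qed.

Lemma reindex_avg (T : finType) (h : T -> T) (g : T -> R) :
  injective h -> avg g = avg (fun x => g (h x)).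
Proof. by move=> hI; rewrite /avg (reindex_inj hI). Qed.

(** Cauchy-Schwarz, from the nonnegativity of the sum of all [(u x * v y - u y * v x) ^+ 2]. *)
Lemma avg_sqr_le (T : finType) (u v : T -> R) :
  avg (fun x => u x * v x) ^+ 2 <=
  avg (fun x => u x ^+ 2) * avg (fun x => v x ^+ 2).
Proof.
suff CS : (\sum_x u x * v x) ^+ 2 <=
          (\sum_x u x ^+ 2) * (\sum_x v x ^+ 2).
  rewrite /avg exprMn [leRHS]mulrACA -expr2 ler_wpM2r //.
  by rewrite exprn_ge0 // invr_ge0 ler0n.
suff : 0 <= \sum_x \sum_y (u x * v y - u y * v x) ^+ 2.
  have -> : \sum_x \sum_y (u x * v y - u y * v x) ^+ 2 =
      \sum_x \sum_y u x ^+ 2 * v y ^+ 2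
      + \sum_x \sum_y u y ^+ 2 * v x ^+ 2
      - 2 * \sum_x \sum_y (u x * v x) * (u y * v y).
    rewrite mulr_sumr -big_split -sumrB; apply: eq_bigr => x _ /=.
    rewrite mulr_sumr -big_split -sumrB; apply: eq_bigr => y _ /=.
    by ring.
  rewrite [X in _ + X - _]exchange_big /= -!big_distrlr /= -expr2.
  lra.
by apply: sumr_ge0 => x _; apply: sumr_ge0 => y _; apply: sqr_ge0.
Qed.

End Average.

Section SymmetricDifference.
Variable T : finType.
Implicit Types A B C : {set T}.

(** Points of the cube are encoded as sets, so this is addition of bit vectors; [symd b [set k]]
    flips coordinate [k]. *)
Definition symd A B : {set T} := [set i | (i \in A) (+) (i \in B)].

Lemma in_symd A B i : (i \in symd A B) = (i \in A) (+) (i \in B).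
Proof. by rewrite inE. Qed.

Lemma symdA A B C : symd A (symd B C) = symd (symd A B) C.
Proof. by apply/setP=> i; rewrite !in_symd addbA. Qed.

Lemma symdC A B : symd A B = symd B A.
Proof. by apply/setP=> i; rewrite !in_symd addbC. Qed.

Lemma symd0 A : symd A set0 = A.
Proof. by apply/setP=> i; rewrite in_symd inE addbF. Qed.

Lemma sym0d A : symd set0 A = A.
Proof. by rewrite symdC symd0. Qed.

Lemma symdd A : symd A A = set0.
Proof. by apply/setP=> i; rewrite in_symd inE addbb. Qed.

Lemma symdK A B : symd (symd A B) B = A.
Proof. by rewrite -symdA symdd symd0. Qed.

Lemma symKd A B : symd A (symd A B) = B.
Proof. by rewrite symdA symdd sym0d. Qed.

Lemma symdI B : injective (symd^~ B).
Proof. by move=> A A' /(congr1 (symd^~ B)); rewrite !symdK. Qed.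

Lemma symId A : injective (symd A).
Proof. by move=> B B' /(congr1 (symd A)); rewrite !symKd. Qed.

End SymmetricDifference.

Lemma card_cube (T : finType) : #|{set T}| = (2 ^ #|T|)%N.
Proof. by have := card_powerset [set: T]; rewrite powersetT !cardsT. Qed.

(** * Walsh characters and hypercontractivity *)

Section Fourier.
Variables (R : realFieldType) (T : finType).
Implicit Types (S b : {set T}) (f g c : {set T} -> R).

(** The Walsh character [(-1) ^+ #|S :&: b|]. The product form is symmetric in [S] and [b], so
    orthogonality is available in either variable. *)
Definition chi S b : R := \prod_i (-1) ^+ ((i \in S) && (i \in b)).

Lemma chiC S b : chi S b = chi b S.
Proof. by apply: eq_bigr => i _; rewrite andbC. Qed.

Lemma chi0 b : chi set0 b = 1.
Proof. by rewrite /chi big1 // => i _; rewrite inE. Qed.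

Lemma chi_symd S S' b : chi (symd S S') b = chi S b * chi S' b.
Proof.
rewrite /chi -big_split; apply: eq_bigr => i _ /=.
by rewrite in_symd -signr_addb andb_addl.
Qed.

Lemma chi_symdr S b b' : chi S (symd b b') = chi S b * chi S b'.
Proof. by rewrite chiC chi_symd !(chiC S). Qed.

Lemma chi_sqr S b : chi S b ^+ 2 = 1.
Proof. by rewrite expr2 -chi_symd symdd chi0. Qed.

Lemma chi1 S k : chi S [set k] = (-1) ^+ (k \in S).
Proof.
rewrite /chi (bigD1 k) //= inE eqxx andbT big1 ?mulr1 // => i ik.
by rewrite inE (negPf ik) andbF.
Qed.

Lemma cube_gt0 : (0 < #|{set T}|)%N.
Proof. by apply/card_gt0P; exists set0. Qed.

(** If [k] is in [S], flipping coordinate [k] negates the character, so its average equals its own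
    opposite. *)
Lemma avg_chi S : avg (chi S) = (S == set0)%:R.
Proof.
case: (set_0Vmem S) => [->|[k kS]].
  by rewrite eqxx (eq_avg chi0) avg_const // cube_gt0.
have -> : (S == set0) = false.
  by apply/negbTE/set0Pn; exists k.
have : avg (chi S) = - avg (chi S).
  rewrite {1}(reindex_avg _ (@symdI _ [set k])) -mulN1r -avgZ.
  by apply: eq_avg => b; rewrite chi_symdr chi1 kS mulrC.
move/eqP; rewrite -addr_eq0 -mulr2n mulrn_eq0 /= => /eqP ->.
by [].
Qed.

Lemma avg_chiM S S' : avg (fun b => chi S b * chi S' b) = (S == S')%:R.
Proof.
rewrite (eq_avg (h := chi (symd S S'))) => [|b]; last by rewrite chi_symd.
rewrite avg_chi; congr (nat_of_bool _)%:R.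
apply/eqP/eqP => [|->]; last exact: symdd.
by move/(congr1 (fun A => symd A S')); rewrite symdK sym0d.
Qed.

Definition fourier f S : R := avg (fun b => f b * chi S b).

Definition walsh c b : R := \sum_S c S * chi S b.

Lemma avg_walsh f c : avg (fun b => f b * walsh c b) = \sum_S c S * fourier f S.
Proof.
under eq_avg => b do rewrite mulr_sumr.
rewrite avg_sum; apply: eq_bigr => S _; rewrite -avgZ; apply: eq_avg => b.
by ring.
Qed.

Lemma fourier_walsh c S : fourier (walsh c) S = c S.
Proof.
rewrite /fourier; under eq_avg => b do rewrite mulr_suml.
rewrite avg_sum (bigD1 S) //= big1 ?addr0 => [|S' S'S].
  under eq_avg => b do rewrite -mulrA.
  by rewrite avgZ avg_chiM eqxx mulr1.
under eq_avg => b do rewrite -mulrA.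
by rewrite avgZ avg_chiM (negPf S'S) mulr0.
Qed.

Lemma avg_walsh_sqr c : avg (fun b => walsh c b ^+ 2) = \sum_S c S ^+ 2.
Proof.
under eq_avg => b do rewrite expr2.
by rewrite avg_walsh; apply: eq_bigr => S _; rewrite fourier_walsh expr2.
Qed.

Lemma walsh_fourier f : walsh (fourier f) =1 f.
Proof.
move=> b; rewrite /walsh.
have -> : \sum_S fourier f S * chi S b =
          \sum_b' f b' * avg (fun S => chi b S * chi b' S).
  rewrite /fourier /avg.
  under eq_bigr => S _ do rewrite mulrAC mulr_suml mulr_suml.
  rewrite exchange_big /=; apply: eq_bigr => b' _.
  rewrite mulr_suml mulr_sumr; apply: eq_bigr => S _.
  by rewrite (chiC b) (chiC b'); ring.
rewrite (bigD1 b) //= big1 ?addr0 => [|b' b'b].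
  by rewrite avg_chiM eqxx mulr1.
by rewrite avg_chiM eq_sym (negPf b'b) mulr0.
Qed.

Lemma parseval f : avg (fun b => f b ^+ 2) = \sum_S fourier f S ^+ 2.
Proof.
rewrite -avg_walsh_sqr; apply: eq_avg => b; by rewrite walsh_fourier.
Qed.

Definition half_diff k f b : R := (f b - f (symd b [set k])) / 2.

Lemma fourier_half_diff k f S :
  fourier (half_diff k f) S = (k \in S)%:R * fourier f S.
Proof.
rewrite /fourier /half_diff.
have -> : avg (fun b => (f b - f (symd b [set k])) / 2 * chi S b) =
   2^-1 * (avg (fun b => f b * chi S b)
           - avg (fun b => f (symd b [set k]) * chi S b)).
  by rewrite -avgB -avgZ; apply: eq_avg => b; ring.
have -> : avg (fun b => f (symd b [set k]) * chi S b) =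
          (-1) ^+ (k \in S) * avg (fun b => f b * chi S b).
  rewrite (reindex_avg _ (@symdI _ [set k])) -avgZ; apply: eq_avg => b.
  by rewrite symdK chi_symdr chi1; ring.
by case: (k \in S) => /=; rewrite ?expr0 ?expr1; field.
Qed.

(** Hypercontractivity from the second to the fourth moment, by induction on a set [J] of
    coordinates containing the spectrum. For [k] in [J] the function is [u + x * v], where [x] is
    the character of [k] and [u], [v] do not depend on [k]. Cauchy-Schwarz on the cross term and the
    induction hypothesis give [N0 ^+ 2 + 6 * N0 * N1 + N1 ^+ 2], at most [(N0 + 3 * N1) ^+ 2]. *)
Lemma bonami c :
  avg (fun b => walsh c b ^+ 4) <= (\sum_(S : {set T}) 3 ^+ #|S| * c S ^+ 2) ^+ 2.
Proof.
suff H (J : {set T}) (c' : {set T} -> R) : (forall S, c' S != 0 -> S \subset J) ->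
  avg (fun b => walsh c' b ^+ 4) <= (\sum_(S : {set T}) 3 ^+ #|S| * c' S ^+ 2) ^+ 2.
  by apply: (H setT) => S _; apply: subsetT.
have [m] := ubnP #|J|; elim: m J c' => // m IHm J c' /ltnSE-leJm supp.
case: (set_0Vmem J) => [J0|[k kJ]].
  have c0 S : S != set0 -> c' S = 0.
    move=> S0; apply: contraNeq S0 => /supp; by rewrite J0 subset0.
  rewrite (bigD1 set0) //= [X in _ <= (_ + X) ^+ 2]big1 => [|S /c0 ->]; last first.
    by rewrite expr0n mulr0.
  rewrite addr0 cards0 expr0 mul1r -exprM.
  rewrite (eq_avg (h := fun _ => c' set0 ^+ 4)) ?avg_const ?cube_gt0 // => b.
  rewrite /walsh (bigD1 set0) //= big1 => [|S /c0 ->]; last by rewrite mul0r.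
  by rewrite addr0 chi0 mulr1.
pose c0 S : R := if k \in S then 0 else c' S.
pose c1 S : R := if k \in S then 0 else c' (symd S [set k]).
have split_sum (h : {set T} -> R) :
    \sum_S h S = \sum_(S : {set T}) (if k \in S then 0 else h S) +
                 \sum_(S : {set T}) (if k \in S then 0 else h (symd S [set k])).
  rewrite (bigID (fun S : {set T} => k \in S)) /= addrC; congr (_ + _).
    by rewrite [LHS]big_mkcond; apply: eq_bigr => S _; case: (k \in S).
  rewrite [LHS]big_mkcond (reindex_inj (@symdI _ [set k])) /=.
  apply: eq_bigr => S _; rewrite in_symd inE eqxx addbT.
  by case: (k \in S).
have walsh_split b : walsh c' b = walsh c0 b + chi [set k] b * walsh c1 b.
  rewrite /walsh split_sum mulr_sumr; congr (_ + _); apply: eq_bigr => S _.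
    by rewrite /c0; case: ifP => _; rewrite ?mul0r.
  by rewrite /c1; case: ifP => _; rewrite ?mul0r ?mulr0 // chi_symd; ring.
pose N0 := \sum_(S : {set T}) 3 ^+ #|S| * c0 S ^+ 2.
pose N1 := \sum_(S : {set T}) 3 ^+ #|S| * c1 S ^+ 2.
have N_split : \sum_(S : {set T}) 3 ^+ #|S| * c' S ^+ 2 = N0 + 3 * N1.
  rewrite split_sum mulr_sumr; congr (_ + _); apply: eq_bigr => S _.
    by rewrite /c0; case: ifP => _; rewrite ?expr0n ?mulr0.
  rewrite /c1; case: ifP => kS; first by rewrite expr0n !mulr0.
  rewrite mulrA -exprS; congr (3 ^+ _ * _).
  have -> : symd S [set k] = k |: S.
    apply/setP=> i; rewrite in_symd !inE; case: eqVneq => [->|_];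
    by rewrite ?kS ?addbF.
  by rewrite cardsU1 kS.
have N0_ge0 : 0 <= N0.
  by apply: sumr_ge0 => S _; rewrite mulr_ge0 ?sqr_ge0 ?exprn_ge0.
have N1_ge0 : 0 <= N1.
  by apply: sumr_ge0 => S _; rewrite mulr_ge0 ?sqr_ge0 ?exprn_ge0.
have IH0 : avg (fun b => walsh c0 b ^+ 4) <= N0 ^+ 2.
  apply: (IHm (J :\ k)).
    by apply: leq_trans leJm; rewrite [ltnRHS](cardsD1 k) kJ.
  move=> S; rewrite /c0; case: ifP => [|kS /supp SJ]; first by rewrite eqxx.
  by rewrite subsetD1 SJ kS.
have IH1 : avg (fun b => walsh c1 b ^+ 4) <= N1 ^+ 2.
  apply: (IHm (J :\ k)).
    by apply: leq_trans leJm; rewrite [ltnRHS](cardsD1 k) kJ.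
  move=> S; rewrite /c1; case: ifP => [|kS /supp SJ]; first by rewrite eqxx.
  rewrite subsetD1 kS andbT; apply/subsetP => i iS; apply: (subsetP SJ).
  rewrite in_symd iS inE; case: eqVneq => // ik.
  by rewrite -ik iS in kS.
have flip_inv (c2 : {set T} -> R) b : (forall S, k \in S -> c2 S = 0) ->
    walsh c2 (symd b [set k]) = walsh c2 b.
  move=> c2k; apply: eq_bigr => S _; rewrite chi_symdr chi1.
  by case: (boolP (k \in S)) => [/c2k -> | _]; rewrite ?mul0r // expr0 mulr1.
(* Averaging with the flip of [k] cancels the odd powers of the character of [k]. *)
have avg4 : avg (fun b => walsh c' b ^+ 4) =
    avg (fun b => walsh c0 b ^+ 4) +
    6 * avg (fun b => walsh c0 b ^+ 2 * walsh c1 b ^+ 2) +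
    avg (fun b => walsh c1 b ^+ 4).
  have two : 2 * avg (fun b => walsh c' b ^+ 4) =
     avg (fun b => walsh c' b ^+ 4) +
     avg (fun b => walsh c' (symd b [set k]) ^+ 4).
    by rewrite -(reindex_avg (fun b => walsh c' b ^+ 4) (@symdI _ [set k])); ring.
  have nz : (2 : R) != 0 by rewrite pnatr_eq0.
  apply: (mulfI nz); rewrite two -avgD -avgZ -!avgD -avgZ.
  apply: eq_avg => b; rewrite !walsh_split !flip_inv; first last.
  - by move=> S kS; rewrite /c0 kS.
  - by move=> S kS; rewrite /c1 kS.
  rewrite chi_symdr chi1 inE eqxx expr1.
  have := chi_sqr [set k] b; set x := chi _ _; set u := walsh _ _.
  set v := walsh _ _ => x2.
  have -> : (u + x * v) ^+ 4 + (u + x * -1 * v) ^+ 4 =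
    2 * (u ^+ 4 + 6 * (u ^+ 2 * v ^+ 2) * x ^+ 2 + v ^+ 4 * (x ^+ 2) ^+ 2).
    by ring.
  by rewrite x2 expr1n !mulr1.
have cross : avg (fun b => walsh c0 b ^+ 2 * walsh c1 b ^+ 2) <= N0 * N1.
  have cross_ge0 : 0 <= avg (fun b => walsh c0 b ^+ 2 * walsh c1 b ^+ 2).
    by apply: avg_ge0 => b; rewrite mulr_ge0 ?sqr_ge0.
  rewrite -ler_sqr ?nnegrE //; last exact: mulr_ge0.
  apply: le_trans (avg_sqr_le _ _) _.
  rewrite exprMn; apply: ler_pM.
  - by apply: avg_ge0 => b; apply: sqr_ge0.
  - by apply: avg_ge0 => b; apply: sqr_ge0.
  - by under eq_avg => b do rewrite -exprM.
  - by under eq_avg => b do rewrite -exprM.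
rewrite avg4 N_split.
have : 0 <= N1 ^+ 2 by apply: sqr_ge0.
move: IH0 IH1 cross; set x := avg _; set y := avg _; set z := avg _.
move=> h0 h1 h2 h3.
have -> : (N0 + 3 * N1) ^+ 2 = N0 ^+ 2 + 6 * (N0 * N1) + 9 * N1 ^+ 2 by ring.
lra.
Qed.

End Fourier.

(** * Influences and low-degree weight *)

Section LowDegree.
Variables (R : realFieldType) (T : finType) (f : {set T} -> bool).

Definition infl (k : T) : R := avg (fun b => (f b != f (symd b [set k]))%:R).

Definition low_weight (d : nat) (k : T) : R :=
  \sum_(S : {set T} | (k \in S) && (#|S| <= d)%N)
     fourier (fun b => (f b)%:R : R) S ^+ 2.

Lemma infl_ge0 k : 0 <= infl k.
Proof. by apply: avg_ge0 => b; apply: ler0n. Qed.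

Lemma low_weight_ge0 d k : 0 <= low_weight d k.
Proof. by apply: sumr_ge0 => S _; apply: sqr_ge0. Qed.

Lemma half_diff_le k b :
  half_diff k (fun b => (f b)%:R : R) b ^+ 2 =
  (f b != f (symd b [set k]))%:R / 4.
Proof. by rewrite /half_diff; case: (f b); case: (f _) => /=; field. Qed.

(** The low weight [W] is the correlation of the half difference, supported on the pivotal points,
    with its own low-degree part. Cauchy-Schwarz twice, each time keeping the indicator [v] of the
    pivotal points, followed by [bonami], gives [W ^+ 4 <= infl k ^+ 3 * 9 ^+ d * W ^+ 2]. *)
Lemma low_weight_sqr d k : low_weight d k ^+ 2 <= 9 ^+ d * infl k ^+ 3.
Proof.
pose g b : R := (f b)%:R.
pose c (S : {set T}) : R :=
  if (k \in S) && (#|S| <= d)%N then fourier g S else 0.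
pose v b : R := (f b != f (symd b [set k]))%:R.
pose dg := half_diff k g.
set W := low_weight d k.
have W0 : 0 <= W by apply: low_weight_ge0.
have p0 := infl_ge0 k.
have Wc : W = \sum_S c S ^+ 2.
  rewrite /W /low_weight big_mkcond; apply: eq_bigr => S _.
  by rewrite /c; case: ifP; rewrite // expr0n.
have Wdg : W = avg (fun b => v b * (dg b * walsh c b)).
  rewrite (eq_avg (h := fun b => dg b * walsh c b)) => [|b].
    rewrite avg_walsh Wc; apply: eq_bigr => S _; rewrite fourier_half_diff /c.
    case: (boolP (k \in S)) => kS /=; last by rewrite expr0n mul0r.
    by case: ifP => _; rewrite ?mul0r ?expr0n // mul1r expr2.
  rewrite mulrA; congr (_ * _); rewrite /v /dg /half_diff /g.
  by case: (f b); case: (f _) => /=; ring.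
have v2 b : v b ^+ 2 = v b by rewrite /v; case: (_ != _); rewrite ?expr1n ?expr0n.
have avg_v2 : avg (fun b => v b ^+ 2) = infl k by apply: eq_avg.
have c4 : avg (fun b => walsh c b ^+ 4) <= 9 ^+ d * W ^+ 2.
  apply: le_trans (bonami _) _.
  have -> : 9 ^+ d * W ^+ 2 = (3 ^+ d * W) ^+ 2.
    have -> : 9 = 3 ^+ 2 :> R by rewrite -natrX.
    by rewrite exprMn; ring.
  rewrite ler_sqr ?nnegrE; first last.
  - by rewrite mulr_ge0 // exprn_ge0.
  - by apply: sumr_ge0 => S _; rewrite mulr_ge0 ?sqr_ge0 ?exprn_ge0.
  rewrite Wc mulr_sumr; apply: ler_sum => S _.
  rewrite /c; case: ifP => [/andP[_ Sd]|_]; last by rewrite expr0n !mulr0.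
  by rewrite ler_wpM2r ?sqr_ge0 // ler_eXn2l // ltr1n.
have step1 : W ^+ 2 <= infl k * avg (fun b => v b * walsh c b ^+ 2).
  rewrite [in leLHS]Wdg; apply: le_trans (avg_sqr_le _ _) _.
  rewrite avg_v2 ler_wpM2l //; apply: ler_avg => b.
  rewrite exprMn ler_wpM2r ?sqr_ge0 // half_diff_le -/(v b).
  by rewrite /v; case: (_ != _) => /=; lra.
have step2 : avg (fun b => v b * walsh c b ^+ 2) ^+ 2 <=
             infl k * (9 ^+ d * W ^+ 2).
  apply: le_trans (avg_sqr_le _ _) _.
  rewrite avg_v2 ler_wpM2l //.
  by under eq_avg => b do rewrite -exprM.
have [->|Wn0] := eqVneq W 0.
  by rewrite expr0n mulr_ge0 ?exprn_ge0.
have W2 : 0 < W ^+ 2 by rewrite exprn_gt0 // lt_neqAle eq_sym Wn0.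
rewrite -(ler_pM2r W2).
have -> : W ^+ 2 * W ^+ 2 = (W ^+ 2) ^+ 2 by rewrite [RHS]expr2.
apply: le_trans (_ : (infl k * avg (fun b => v b * walsh c b ^+ 2)) ^+ 2 <= _).
  have h0 : 0 <= avg (fun b => v b * walsh c b ^+ 2).
    by apply: avg_ge0 => b; rewrite mulr_ge0 ?sqr_ge0 ?ler0n.
  by rewrite ler_sqr ?nnegrE ?sqr_ge0 // mulr_ge0.
rewrite exprMn.
apply: le_trans (ler_wpM2l (sqr_ge0 (infl k)) step2) _.
by rewrite le_eqVlt; apply/orP; left; apply/eqP; ring.
Qed.

(** The arithmetic-geometric inequality linearises the power 3/2 of the influence, so that averaging
    over random restrictions involves only its first two moments. *)
Lemma low_weight_le d k (s : R) : 0 < s ->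
  low_weight d k <= 3 ^+ d * (s * infl k + infl k ^+ 2 / s).
Proof.
move=> s0; have p0 := infl_ge0 k.
have r0 : 0 <= s * infl k + infl k ^+ 2 / s.
  by apply: addr_ge0; apply: mulr_ge0; rewrite ?invr_ge0 ?sqr_ge0 ?(ltW s0).
rewrite -ler_sqr ?nnegrE ?low_weight_ge0 ?mulr_ge0 ?exprn_ge0 //.
apply: le_trans (low_weight_sqr _ _) _.
rewrite [leRHS]exprMn.
have -> : (3 ^+ d) ^+ 2 = 9 ^+ d :> R by rewrite expr2 -exprMn -natrM.
rewrite ler_wpM2l ?exprn_ge0 //.
have -> : (s * infl k + infl k ^+ 2 / s) ^+ 2 =
  (s * infl k - infl k ^+ 2 / s) ^+ 2 + 4 * infl k ^+ 3.
  by field; rewrite gt_eqF.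
have := sqr_ge0 (s * infl k - infl k ^+ 2 / s).
have := exprn_ge0 3 p0.
lra.
Qed.

(* Levels above [d] are controlled by the energy [\sum_S #|S| f^(S)^2], the
   others by hypercontractivity. *)
Lemma variance_le d (s : R) : 0 < s ->
  avg (fun b => (f b)%:R ^+ 2 : R) - avg (fun b => (f b)%:R : R) ^+ 2 <=
  \sum_k (infl k / (4 * d.+1%:R)
          + 3 ^+ d * (s * infl k + infl k ^+ 2 / s)).
Proof.
move=> s0; pose g b : R := (f b)%:R.
have d0 : 0 < d.+1%:R :> R by rewrite ltr0n.
have energy k : infl k / 4 = \sum_(S : {set T} | k \in S) fourier g S ^+ 2.
  rewrite big_mkcond /=.
  have -> : \sum_(S : {set T}) (if k \in S then fourier g S ^+ 2 else 0) =
            avg (fun b => half_diff k g b ^+ 2).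
    rewrite parseval; apply: eq_bigr => S _; rewrite fourier_half_diff.
    by case: (k \in S); rewrite ?mul1r // mul0r expr0n.
  rewrite /infl mulrC -avgZ; apply: eq_avg => b.
  by rewrite half_diff_le mulrC.
apply: (@le_trans _ _ (\sum_k (infl k / 4 / d.+1%:R + low_weight d k))); last first.
  apply: ler_sum => k _; apply: lerD; last exact: low_weight_le.
  by rewrite -mulrA -invfM.
rewrite parseval (bigD1 set0) //=.
have -> : fourier g set0 = avg g.
  by apply: eq_avg => b; rewrite chi0 mulr1.
rewrite addrAC subrr add0r.
(* A nonempty [S] is counted once for each of its elements, with weight [1 / (d + 1)] plus 1 if
   [#|S| <= d]; in both cases the total weight is at least 1. *)
have -> : \sum_k (infl k / 4 / d.+1%:R + low_weight d k) =
  \sum_(S : {set T}) \sum_(k in S)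
     fourier g S ^+ 2 * (d.+1%:R^-1 + (#|S| <= d)%N%:R).
  rewrite [RHS](exchange_big_dep predT) //=; apply: eq_bigr => k _.
  under [RHS]eq_bigr => S _ do rewrite mulrDr.
  rewrite big_split /= -mulr_suml -energy; congr (_ + _).
  rewrite /low_weight big_mkcondr /=; apply: eq_bigr => S _.
  by case: (_ <= _)%N; rewrite ?mulr1 ?mulr0.
rewrite [leRHS](bigD1 set0) //= [in leRHS]big_set0 add0r.
apply: ler_sum => S S0.
rewrite sumr_const -[leRHS]mulr_natr -mulrA ler_peMr ?sqr_ge0 //.
have : (0 < #|S|)%N by rewrite card_gt0.
case: (leqP #|S| d) => Sd cS /=.
  rewrite mulrDl mul1r ler_wpDl ?ler1n // mulr_ge0 ?ler0n //.
  by rewrite invr_ge0 ler0n.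
by rewrite addr0 mulrC ler_pdivlMr // mul1r ler_nat.
Qed.

End LowDegree.

(** * Random embeddings of the cube in a layer *)

Section PermutationAction.
Variable T : finType.
Implicit Types (s t : {perm T}) (x y A B : {set T}).

Definition permpre s x : {set T} := [set p | s p \in x].

Lemma in_permpre s x p : (p \in permpre s x) = (s p \in x).
Proof. by rewrite inE. Qed.

Lemma permpre_comp s t x : permpre s (permpre t x) = permpre (s * t)%g x.
Proof. by apply/setP=> p; rewrite !in_permpre permM. Qed.

Lemma permpreKV s x : permpre s^-1%g (permpre s x) = x.
Proof. by apply/setP=> p; rewrite !in_permpre permKV. Qed.

Lemma permpre_inj s : injective (permpre s).
Proof. exact: can_inj (permpreKV s). Qed.

Lemma card_permpre s x : #|permpre s x| = #|x|.
Proof.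
rewrite -[RHS](card_preimset _ (@perm_inj _ s)).
by apply: eq_card => p; rewrite !inE.
Qed.

Lemma permpreS s x y : x \subset y -> permpre s x \subset permpre s y.
Proof. by move/subsetP=> xy; apply/subsetP=> p; rewrite !in_permpre; apply: xy. Qed.

Lemma permpre_symd s x y :
  permpre s (symd x y) = symd (permpre s x) (permpre s y).
Proof. by apply/setP=> p; rewrite !(in_symd, in_permpre). Qed.

Lemma permpre1 s p : permpre s [set p] = [set s^-1%g p].
Proof.
apply/setP=> q; rewrite in_permpre !inE.
by apply/eqP/eqP => [<-|->]; rewrite ?permK ?permKV.
Qed.

(** Built from transpositions, each exchanging a point of [A] outside [B] with a point of [B]
    outside [A]. The second clause ensures that sets disjoint from [A] and [B] are preserved. *)
Lemma ex_permpre A B : #|A| = #|B| ->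
  exists2 s, permpre s A = B & forall i, i \notin A -> i \notin B -> s i = i.
Proof.
have [m] := ubnP #|A :\: B|; elim: m A => // m IHm A /ltnSE-leAm AB.
have [A_B|[a]] := set_0Vmem (A :\: B).
  have -> : B = A.
    apply/esym/eqP; rewrite eqEcard AB leqnn andbT.
    by rewrite -setD_eq0 A_B eqxx.
  by exists 1%g => [|i _ _]; [apply/setP=> i; rewrite in_permpre perm1|rewrite perm1].
rewrite inE => /andP[aB aA].
have [b] : exists b, b \in B :\: A.
  apply/set0Pn; rewrite -card_gt0 lt0n; apply/eqP => /eqP.
  rewrite cards_eq0 setD_eq0 => BA.
  have /eqP ABe : B == A by rewrite eqEcard BA AB leqnn.
  by rewrite -ABe in aA; rewrite aA in aB.
rewrite inE => /andP[bA bB].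
pose t := tperm a b.
have [||s sA' sfix] := IHm (permpre t A).
- apply: leq_trans leAm; rewrite [ltnRHS](cardsD1 a) inE aB aA ltnS.
  apply: subset_leq_card; apply/subsetP=> x; rewrite !inE => /andP[xB].
  have xb : x != b by apply: contraNneq xB => ->.
  have [->|xa] := eqVneq x a; first by rewrite tpermL (negPf bA).
  by rewrite tpermD 1?eq_sym // xB.
- by rewrite card_permpre.
exists (s * t)%g; first by rewrite -permpre_comp.
move=> i iA iB; have ia : i != a by apply: contraNneq iA => ->.
have ib : i != b by apply: contraNneq iB => ->.
have ti : t i = i by rewrite tpermD 1?eq_sym.
by rewrite permM sfix // in_permpre ti.
Qed.

End PermutationAction.

Section LayerAverage.
Variables (R : realFieldType) (T : finType).
Implicit Types (g : {set T} -> R) (x y : {set T}).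

Definition layer_avg g (j : nat) : R :=
  (\sum_(x : {set T} | #|x| == j) g x) / 'C(#|T|, j)%:R.

Lemma perm_gt0 : (0 < #|{perm T}|)%N.
Proof. by apply/card_gt0P; exists 1%g. Qed.

Lemma reindex_avg_perm (h : {perm T} -> R) (t : {perm T}) :
  avg h = avg (fun s => h (s * t)%g).
Proof. exact: (reindex_avg h (@mulIg _ t)). Qed.

Lemma sum_layer_permpre g j s :
  \sum_(x : {set T} | #|x| == j) g (permpre s x) =
  \sum_(x : {set T} | #|x| == j) g x.
Proof.
rewrite [RHS](reindex_inj (@permpre_inj _ s)) /=.
by apply: eq_bigl => x; rewrite card_permpre.
Qed.

(** A uniform permutation carries a fixed [j]-set to a uniform one: the average is the same for all
    [j]-sets, and the sum over the layer is invariant under each permutation. *)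
Lemma avg_permpre g x j : #|x| = j ->
  avg (fun s => g (permpre s x)) = layer_avg g j.
Proof.
move=> xj.
have jT : (j <= #|T|)%N by rewrite -xj max_card.
have C0 : 'C(#|T|, j)%:R != 0 :> R by rewrite pnatr_eq0 -lt0n bin_gt0.
apply: (mulIf C0); rewrite mulfVK //.
transitivity (\sum_(y : {set T} | #|y| == j) avg (fun s => g (permpre s y))).
  rewrite -card_draws -sum1_card natr_sum mulr_sumr.
  apply: eq_big => y; first by rewrite inE.
  rewrite inE mulr1 => /eqP yj.
  have [|t tx _] := @ex_permpre T x y; first by rewrite xj.
  rewrite (reindex_avg_perm _ t); apply: eq_avg => s.
  by rewrite -tx permpre_comp.
rewrite -avg_sum.
under eq_avg => s do rewrite sum_layer_permpre.
by rewrite avg_const // perm_gt0.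
Qed.

End LayerAverage.

(** * Matched pairs of coordinates and exchangeability *)

Section PairedCube.
Variable n : nat.
Local Notation P := ('I_n * bool)%type.
Implicit Types (U V b K A B : {set 'I_n}) (p : P).

(** A subset of the [2n] coordinates is given by its trace [U] on the [true] copy and its trace [V]
    on the [false] copy. *)
Definition mkset U V : {set P} :=
  [set p | if p.2 then p.1 \in U else p.1 \in V].

Lemma in_mkset U V p : (p \in mkset U V) = if p.2 then p.1 \in U else p.1 \in V.
Proof. by rewrite inE. Qed.

Definition fstset (x : {set P}) : {set 'I_n} := [set i | (i, true) \in x].
Definition sndset (x : {set P}) : {set 'I_n} := [set i | (i, false) \in x].

Lemma fst_mkset U V : fstset (mkset U V) = U.
Proof. by apply/setP=> i; rewrite !inE. Qed.

Lemma snd_mkset U V : sndset (mkset U V) = V.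
Proof. by apply/setP=> i; rewrite !inE. Qed.

Lemma mkset_fst_snd x : mkset (fstset x) (sndset x) = x.
Proof. by apply/setP=> -[i []]; rewrite !inE. Qed.

Lemma card_mkset U V : #|mkset U V| = (#|U| + #|V|)%N.
Proof.
have inj (e : bool) : injective (fun i : 'I_n => (i, e)) by move=> i j [].
rewrite -(card_imset U (inj true)) -(card_imset V (inj false)) -cardsUI.
rewrite [X in (_ + X)%N](_ : _ = 0) ?addn0; last first.
  apply/eqP; rewrite cards_eq0 -subset0; apply/subsetP=> p.
  by rewrite inE => /andP[/imsetP[i _ ->] /imsetP[]].
apply: eq_card => -[i e]; rewrite !inE /=.
case: e.
  apply/idP/orP => [iU|[/imsetP[j jU [->]]|/imsetP[]]] //.
  by left; apply: imset_f.
apply/idP/orP => [iU|[/imsetP[]|/imsetP[j jU [->]]]] //.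
by right; apply: imset_f.
Qed.

Lemma sum_mkset (R : realFieldType) (g : {set P} -> R) :
  \sum_x g x = \sum_U \sum_V g (mkset U V).
Proof.
rewrite pair_big /= (reindex (fun q : {set 'I_n} * {set 'I_n} => mkset q.1 q.2)) //=.
exists (fun x => (fstset x, sndset x)) => [[U V] _|x _] /=.
  by rewrite fst_mkset snd_mkset.
by rewrite mkset_fst_snd.
Qed.

(* The reference matching is made of the pairs [(i, false), (i, true)]; a uniform
   [s : {perm P}] turns it into a uniformly random matching. *)
Definition pick_pt b : {set P} := mkset (~: b) b.

Lemma in_pick_pt b p : (p \in pick_pt b) = p.2 (+) (p.1 \in b).
Proof. by rewrite in_mkset inE; case: p.2. Qed.

Lemma card_pick_pt b : #|pick_pt b| = n.
Proof. by rewrite card_mkset addnC cardsC card_ord. Qed.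

Lemma pick_pt_symd b K : pick_pt (symd b K) = symd (pick_pt b) (mkset K K).
Proof.
apply/setP=> p; rewrite in_symd !in_pick_pt in_symd in_mkset addbA.
by rewrite if_same.
Qed.

(** Exchanges the two ends of each pair indexed by [b]: the matching is kept and the points of its
    subcube are translated by [b]. *)
Definition switch_fun b p : P := (p.1, p.2 (+) (p.1 \in b)).

Lemma switch_funK b : involutive (switch_fun b).
Proof. by move=> [i e]; rewrite /switch_fun /= -addbA addbb addbF. Qed.

Definition switch b : {perm P} := perm (inv_inj (switch_funK b)).

Lemma permpre_switch_pick b b' :
  permpre (switch b) (pick_pt b') = pick_pt (symd b b').
Proof.
by apply/setP=> p; rewrite in_permpre permE !in_pick_pt in_symd addbA.
Qed.

Lemma permpre_switch_mkset b K : permpre (switch b) (mkset K K) = mkset K K.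
Proof. by apply/setP=> p; rewrite in_permpre permE !in_mkset /= !if_same. Qed.

(** Permutes the [true] ends only, hence changes the matching while fixing the base point
    [pick_pt set0], the set of all [true] ends. *)
Definition lift_fun (s : {perm 'I_n}) p : P := if p.2 then (s p.1, true) else p.

Lemma lift_fun_inj s : injective (lift_fun s).
Proof. by move=> [i []] [j []] //= [] /perm_inj ->. Qed.

Definition lift_perm s : {perm P} := perm (@lift_fun_inj s).

Lemma permpre_lift s U V : permpre (lift_perm s) (mkset U V) = mkset (permpre s U) V.
Proof. by apply/setP=> -[i []]; rewrite in_permpre permE !inE. Qed.

Section Exchange.
Variables (R : realFieldType) (G : {set P} -> {set P} -> {set P} -> R).

(** Composing the random permutation with [switch b] moves the first point to the base point, so the
    joint law depends only on the difference of the two points. *)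
Lemma avg_pick_symd K b b' :
  avg (fun s => G (permpre s (pick_pt b)) (permpre s (mkset K K))
                  (permpre s (pick_pt b'))) =
  avg (fun s => G (permpre s (pick_pt set0)) (permpre s (mkset K K))
                  (permpre s (pick_pt (symd b b')))).
Proof.
rewrite (reindex_avg_perm _ (switch b)); apply: eq_avg => s.
by rewrite -!permpre_comp !permpre_switch_pick permpre_switch_mkset symdd.
Qed.

(** A permutation of the [true] ends carrying [A] to [B] and preserving [K] fixes the base point and
    both ends of the pairs in [K]. Hence swapping [B] out and [A] in has the same law as moving
    along the pairs of [A]. *)
Lemma avg_exchange K A B : #|A| = #|B| -> [disjoint A & K] -> [disjoint B & K] ->
  avg (fun s => G (permpre s (pick_pt set0)) (permpre s (mkset K K))
                  (permpre s (mkset (~: B) A))) =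
  avg (fun s => G (permpre s (pick_pt set0)) (permpre s (mkset K K))
                  (permpre s (pick_pt A))).
Proof.
move=> AB AK BK; have [t tA tfix] := ex_permpre AB.
rewrite [RHS](reindex_avg_perm _ (lift_perm t)); apply: eq_avg => s.
rewrite -!permpre_comp !permpre_lift.
have -> : permpre t (~: set0) = ~: set0 by apply/setP=> i; rewrite !inE.
have -> : permpre t (~: A) = ~: B.
  by apply/setP=> i; rewrite -tA !inE.
suff -> : permpre t K = K by [].
apply/setP=> i; rewrite in_permpre.
have notK (C : {set 'I_n}) j : [disjoint C & K] -> j \in K -> j \notin C.
  by move=> CK jK; apply: contraL jK => jC; rewrite (disjointFr CK jC).
apply/idP/idP => iK; last first.
  by rewrite tfix // (notK A i AK iK, notK B i BK iK).
have tiA := notK A _ AK iK; have tiB := notK B _ BK iK.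
suff <- : t i = i by [].
have := tfix _ tiA tiB; exact: perm_inj.
Qed.

End Exchange.
End PairedCube.

(** * Binomial estimates *)

Section BinomialNat.
Local Open Scope nat_scope.

Lemma leq_bin_succ n i : i.*2.+1 <= n -> 'C(n, i) <= 'C(n, i.+1).
Proof.
move=> hi; rewrite -(leq_pmul2l (ltn0Sn i)) mul_bin_left leq_mul2r.
by apply/orP; right; lia.
Qed.

Lemma leq_bin_half n i l : i <= l -> l.*2 <= n.+1 -> 'C(n, i) <= 'C(n, l).
Proof.
elim: l => [|l IHl]; first by rewrite leqn0 => /eqP ->.
rewrite leq_eqVlt => /orP[/eqP -> //|]; rewrite ltnS => il ln.
by apply: leq_trans (IHl il _) (leq_bin_succ _); lia.
Qed.

Lemma leq_bin_mid n i l : i <= l -> l + i <= n -> 'C(n, i) <= 'C(n, l).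
Proof.
move=> il lin; have [ln|ln] := leqP l.*2 n; first by apply: leq_bin_half; lia.
by rewrite -(@bin_sub n l); [apply: leq_bin_half; lia | lia].
Qed.

Lemma leq_bin_center n i : 'C(n, i) <= 'C(n, n./2).
Proof.
have [ni|ni] := ltnP n i; first by rewrite bin_small.
have := odd_double_half n => e.
have [hi|hi] := leqP i n./2; first by apply: leq_bin_mid => //; lia.
by rewrite -(bin_sub ni); apply: leq_bin_mid; lia.
Qed.

Lemma sum_bin n : \sum_(i < n.+1) 'C(n, i) = 2 ^ n.
Proof.
by rewrite -[2]/(1 + 1) expnDn; apply: eq_bigr => i _; rewrite !exp1n !muln1.
Qed.

(** By unimodality the [n - 2i + 1] coefficients of index between [i] and [n - i] are all at least
    ['C(n, i)], and their sum is at most [2 ^ n]. Past the middle the truncated difference is 0. *)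
Lemma bin_dist_center n i : (n - i.*2 + 1) * 'C(n, i) <= 2 ^ n.
Proof.
have [ni|ni] := leqP n i.*2.
  have -> : n - i.*2 = 0 by lia.
  rewrite mul1n -sum_bin; have [nli|nli] := leqP i n; last by rewrite bin_small.
  by rewrite (bigD1 (inord i : 'I_n.+1)) //= inordK // leq_addr.
rewrite -sum_bin -(big_mkord xpredT (fun j => 'C(n, j))).
rewrite (@big_cat_nat _ _ _ i) //=; last by lia.
rewrite (@big_cat_nat _ _ _ (n - i).+1 i) //=; try lia.
apply: leq_trans (leq_addl _ _); apply: leq_trans (leq_addr _ _).
have -> : n - i.*2 + 1 = (n - i).+1 - i by lia.
rewrite -sum_nat_const_nat big_nat [leqRHS]big_nat.
by apply: leq_sum => l /andP[il li]; apply: leq_bin_mid; lia.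
Qed.

(** The sum of the two truncated differences is the absolute value of [n - 2i]. *)
Lemma bin_dist_center_abs n i : (n - i.*2 + (i.*2 - n)) * 'C(n, i) <= 2 ^ n.
Proof.
have [ni|ni] := leqP n i; last first.
  have [h|h] := leqP i.*2 n.
    apply: leq_trans (bin_dist_center n i); rewrite leq_mul2r; lia.
  rewrite -(bin_sub (ltnW ni)); apply: leq_trans (bin_dist_center n (n - i)).
  by rewrite leq_mul2r; lia.
move: ni; rewrite leq_eqVlt => /orP[/eqP <-|ni]; last by rewrite bin_small // muln0.
rewrite binn; have := ltn_expl n (isT : 1 < 2); lia.
Qed.

Lemma central_bin_succ m :
  m.+1 * 'C(m.+1.*2, m.+1) = (m.*2.+1).*2 * 'C(m.*2, m).
Proof.
rewrite doubleS -mul_bin_diag /= -[m.*2.+2]/(m.+1.*2) -mul2n -mulnA.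
rewrite -[m.*2.+1 in LHS]/(m.*2.+1) -(@bin_sub m.*2.+1 m); last by lia.
have -> : m.*2.+1 - m = m.+1 by lia.
rewrite -mul_bin_diag /=; lia.
Qed.

(** Squaring avoids square roots. With the factor [3m + 1] the induction step becomes a true
    polynomial inequality. *)
Lemma central_bin_upper m : 'C(m.*2, m) ^ 2 * (3 * m).+1 <= 16 ^ m.
Proof.
elim: m => // m IHm; have := central_bin_succ m.
move: IHm; set c := 'C(m.*2, m); set c' := 'C(_, _) => IHm h.
have m2 : 0 < m.+1 ^ 2 by rewrite expn_gt0.
rewrite -(leq_pmul2l m2) mulnA -expnMn h [16 ^ m.+1]expnS.
have poly : (m.*2.+1).*2 ^ 2 * (3 * m.+1).+1 <= 16 * m.+1 ^ 2 * (3 * m).+1.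
  by rewrite -!mulnn; nia.
apply: (@leq_trans (16 * m.+1 ^ 2 * (c ^ 2 * (3 * m).+1))).
  rewrite [leqLHS](_ : _ = (m.*2.+1).*2 ^ 2 * (3 * m.+1).+1 * c ^ 2);
    last by rewrite expnMn mulnAC.
  rewrite [leqRHS](_ : _ = 16 * m.+1 ^ 2 * (3 * m).+1 * c ^ 2);
    last by rewrite [c ^ 2 * _]mulnC mulnA.
  by rewrite leq_mul2r poly orbT.
rewrite [leqRHS](_ : _ = 16 * m.+1 ^ 2 * 16 ^ m);
    last by rewrite mulnCA mulnA.
by rewrite leq_mul2l IHm orbT.
Qed.

Lemma central_bin_lower m : 0 < m -> 16 ^ m <= 'C(m.*2, m) ^ 2 * (4 * m).
Proof.
case: m => // m _; elim: m => // m IHm; have := central_bin_succ m.+1.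
move: IHm; set c := 'C(m.+1.*2, _); set c' := 'C(_, _) => IHm h.
have m2 : 0 < m.+2 ^ 2 by rewrite expn_gt0.
rewrite -(leq_pmul2l m2) mulnA -expnMn h [16 ^ m.+2]expnS.
have poly : 16 * m.+2 ^ 2 * (4 * m.+1) <= (m.+1.*2.+1).*2 ^ 2 * (4 * m.+2).
  by rewrite -!mulnn; nia.
apply: (@leq_trans (16 * m.+2 ^ 2 * (c ^ 2 * (4 * m.+1)))).
  rewrite [leqLHS](_ : _ = 16 * m.+2 ^ 2 * 16 ^ m.+1);
    last by rewrite mulnCA mulnA.
  by rewrite leq_mul2l IHm orbT.
rewrite [leqLHS](_ : _ = 16 * m.+2 ^ 2 * (4 * m.+1) * c ^ 2);
    last by rewrite [c ^ 2 * _]mulnC mulnA.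
rewrite [leqRHS](_ : _ = (m.+1.*2.+1).*2 ^ 2 * (4 * m.+2) * c ^ 2);
    last by rewrite expnMn mulnAC.
by rewrite leq_mul2r poly orbT.
Qed.

(** Reduces to the middle coefficient; for odd [n] it is half of the next central coefficient. *)
Lemma bin_sqr_upper n k : 'C(n, k) ^ 2 * n <= 4 ^ n.
Proof.
apply: leq_trans (_ : 'C(n, n./2) ^ 2 * n <= _).
  by rewrite leq_mul2r leq_exp2r // leq_bin_center orbT.
have := odd_double_half n; set m := n./2.
case: (odd n) => /= <-; last first.
  rewrite add0n -mul2n expnM (_ : 4 ^ 2 = 16) //; apply: leq_trans (central_bin_upper m).
  by rewrite mul2n leq_mul2l; lia.
have h := central_bin_upper m.+1.
have e : 'C(m.+1.*2, m.+1) = 2 * 'C(m.*2.+1, m).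
  rewrite doubleS binS -(@bin_sub m.*2.+1 m); last by lia.
  have -> : m.*2.+1 - m = m.+1 by lia.
  by rewrite mul2n addnn.
have -> : 4 ^ (1 + m.*2) = 4 * 16 ^ m.
  by rewrite add1n expnS -mul2n expnM (_ : 4 ^ 2 = 16).
rewrite e expnMn [16 ^ m.+1]expnS in h; rewrite add1n.
apply: (@leq_trans ('C(m.*2.+1, m) ^ 2 * (3 * m.+1).+1)).
  by rewrite leq_mul2l; apply/orP; right; lia.
by rewrite -(leq_pmul2l (isT : 0 < 4)) mulnA; apply: leq_trans h _; rewrite mulnA.
Qed.

(** This is the comparison of laws: a weight ['C(n, k) / 'C(2n, n)] coming from the middle layer is
    at most twice the weight [2 ^ (- n)] of a point of the cube. *)
Lemma bin_le_central n k : 0 < n -> 2 ^ n * 'C(n, k) <= 2 * 'C(n.*2, n).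
Proof.
move=> n0; rewrite -leq_sqr -(leq_pmul2r n0).
have -> : (2 ^ n * 'C(n, k)) ^ 2 * n = 4 ^ n * ('C(n, k) ^ 2 * n).
  by rewrite expnMn -expnM [(n * 2)%N]mulnC expnM (_ : 2 ^ 2 = 4) // -mulnA.
have -> : (2 * 'C(n.*2, n)) ^ 2 * n = 'C(n.*2, n) ^ 2 * (4 * n).
  by rewrite expnMn (_ : 2 ^ 2 = 4) // [(4 * _)%N]mulnC -mulnA.
apply: leq_trans (central_bin_lower n0).
by rewrite -[16]/(4 * 4) expnMn leq_mul2l bin_sqr_upper orbT.
Qed.

Lemma central_bin_le4 m : 'C(m.+1.*2, m.+1) <= 4 * 'C(m.*2, m).
Proof.
rewrite -(leq_pmul2l (ltn0Sn m)) central_bin_succ; nia.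
Qed.

End BinomialNat.

(** * Binomial mass carried by small coefficients *)

Section BinomialTail.
Variable R : realFieldType.

Lemma sum_bin_succ (g : nat -> R) m :
  \sum_(t < m.+2) 'C(m.+1, t)%:R * g t =
  \sum_(t < m.+1) 'C(m, t)%:R * (g t + g t.+1).
Proof.
rewrite big_ord_recl bin0 mul1r.
under eq_bigr => i _ do rewrite lift0 binS natrD mulrDl.
rewrite big_split /= big_ord_recr /= bin_small // mul0r addr0.
under [RHS]eq_bigr => i _ do rewrite mulrDr.
rewrite big_split /= [X in _ = X + _]big_ord_recl bin0 mul1r -addrA.
by congr (_ + (_ + _)).
Qed.

Lemma sum_bin_natr m : \sum_(t < m.+1) 'C(m, t)%:R = 2 ^+ m :> R.
Proof. by rewrite -natr_sum sum_bin natrX. Qed.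

(** The variance of a sum of [m] independent signs, by Pascal's rule. *)
Lemma binomial_second_moment m :
  \sum_(t < m.+1) 'C(m, t)%:R * (m%:R - t%:R *+ 2) ^+ 2 = m%:R * 2 ^+ m :> R.
Proof.
elim: m => [|m IHm]; first by rewrite big_ord1 /= mul0rn subrr expr0n mulr0 mul0r.
rewrite (sum_bin_succ (fun t => (m.+1%:R - t%:R *+ 2) ^+ 2)).
transitivity (\sum_(t < m.+1) (2 * ('C(m, t)%:R * (m%:R - t%:R *+ 2) ^+ 2)
                              + 2 * 'C(m, t)%:R) : R).
  by apply: eq_bigr => t _; rewrite -[m.+1%:R]natr1 -[t.+1%:R]natr1; ring.
rewrite big_split /= -!mulr_sumr IHm sum_bin_natr exprS -[m.+1%:R]natr1; ring.
Qed.

Lemma window_card m X :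
  (#|[pred t : 'I_m.+1 | (m < t.*2 + X) && (t.*2 < m + X)]| <= X.+1)%N.
Proof.
rewrite cardE -(size_map val) -(size_iota (m - X)./2 X.+1).
apply: uniq_leq_size; first by rewrite map_inj_uniq ?enum_uniq //; apply: val_inj.
move=> x /mapP[t]; rewrite mem_enum inE => /andP[h1 h2] ->.
by rewrite mem_iota /=; have := odd_double_half (m - X); case: (odd _) => /=; lia.
Qed.

(** Chebyshev's inequality handles the indices with [|m - 2t| >= X]; at most [X + 1] indices remain,
    each contributing less than [th]. *)
Lemma binomial_small_mass m X (th : R) : (0 < X)%N -> 0 <= th ->
  \sum_(t < m.+1 | 'C(m, t)%:R < th) 'C(m, t)%:R <=
  m%:R * 2 ^+ m / X%:R ^+ 2 + X.+1%:R * th.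
Proof.
move=> X0 th0; have X2 : 0 < X%:R ^+ 2 :> R by rewrite exprn_gt0 // ltr0n.
pose win (t : 'I_m.+1) := (m < t.*2 + X)%N && (t.*2 < m + X)%N.
apply: (@le_trans _ _ (\sum_(t < m.+1)
   ('C(m, t)%:R * (m%:R - t%:R *+ 2) ^+ 2 / X%:R ^+ 2 + (win t)%:R * th))).
  rewrite big_mkcond; apply: ler_sum => t _.
  have q0 : 0 <= 'C(m, t)%:R * (m%:R - t%:R *+ 2) ^+ 2 / X%:R ^+ 2 :> R.
    by rewrite divr_ge0 ?(ltW X2) // mulr_ge0 ?ler0n ?sqr_ge0.
  have r0 : 0 <= (win t)%:R * th by rewrite mulr_ge0 ?ler0n.
  case: ifP => [Cth|_]; last exact: addr_ge0.
  case: (boolP (win t)) => [_|nwin]; first by rewrite mul1r ler_wpDl // ltW.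
  rewrite mul0r addr0 -mulrA ler_peMr ?ler0n // ler_pdivlMr // mul1r.
  have [h|h] : ((t.*2 + X <= m) \/ (m + X <= t.*2))%N.
    by move: nwin; rewrite /win negb_and -!leqNgt => /orP[]; auto.
    have : (t.*2 + X)%:R <= m%:R :> R by rewrite ler_nat.
    rewrite -mul2n natrD natrM => h'.
    rewrite ler_sqr ?nnegrE ?ler0n //; last by have := ler0n R X; lra.
    by rewrite -[_ *+ 2]mulr_natl; lra.
  have : (m + X)%:R <= t.*2%:R :> R by rewrite ler_nat.
  rewrite -mul2n natrD natrM => h'.
  rewrite -[leRHS]sqrrN ler_sqr ?nnegrE ?ler0n //; last by have := ler0n R X; lra.
  by rewrite -[_ *+ 2]mulr_natl; lra.
rewrite big_split /= -!mulr_suml binomial_second_moment lerD2l ler_wpM2r //.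
rewrite -natr_sum ler_nat; apply: leq_trans (window_card m X).
rewrite -sum1_card [leqRHS]big_mkcond; apply: leq_sum => t _.
by rewrite inE -/(win t); case: (win t).
Qed.

End BinomialTail.

(** * Restriction of a family to a random subcube *)

Section Slice.
Variables (R : realFieldType) (n : nat).
Local Notation P := ('I_n * bool)%type.
Implicit Types (A B K b : {set 'I_n}) (x y z w : {set P}) (s : {perm P}).

Lemma card_pairs : #|{: P}| = n.*2.
Proof. by rewrite card_prod card_ord card_bool muln2. Qed.

(** Each [n]-set arises from the set of all [true] ends by removing a set [B] of them and adding
    equally many [false] ends [A]. *)
Lemma sum_layer_exchange (h : {set P} -> R) :
  \sum_(x : {set P} | #|x| == n) h x =
  \sum_(A : {set 'I_n}) \sum_(B : {set 'I_n} | #|B| == #|A|) h (mkset (~: B) A).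
Proof.
rewrite big_mkcond sum_mkset exchange_big; apply: eq_bigr => A _ /=.
rewrite [RHS]big_mkcond (reindex_inj (@setC_inj _)); apply: eq_bigr => B _.
rewrite card_mkset.
have -> : (#|~: B| + #|A| == n)%N = (#|B| == #|A|); last by [].
by have := cardsC B; rewrite card_ord; lia.
Qed.

Variable F : {set P} -> bool.

Definition subcube s b : bool := F (permpre s (pick_pt b)).

Local Notation Fr := (fun x => (F x)%:R : R).
Local Notation alpha := (layer_avg Fr n).
Local Notation beta := (layer_avg Fr n.+1).

(** Two independent points of the layer differ under [F] with probability [2 * alpha * (1 - alpha)].
    By exchangeability this is the sum of [u A] with weights ['C(n, #|A|) / 'C(2n, n)], while the
    uniform average of [u] is twice the mean variance of the restriction; [bin_le_central] compares
    the weights. *)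
Lemma slice_variance : (0 < n)%N ->
  alpha * (1 - alpha) <= 2 * avg (fun s =>
    avg (fun b => (subcube s b)%:R ^+ 2 : R)
    - avg (fun b => (subcube s b)%:R : R) ^+ 2).
Proof.
move=> n0.
pose G (y w x : {set P}) : R := (Fr y - Fr x) ^+ 2.
pose w0 : {set P} := mkset set0 set0.
pose u A := avg (fun s => G (permpre s (pick_pt set0)) (permpre s w0)
                            (permpre s (pick_pt A))).
pose C : R := 'C(n.*2, n)%:R.
have C0 : 0 < C by rewrite ltr0n bin_gt0; lia.
have sumF : \sum_(x : {set P} | #|x| == n) Fr x = C * alpha.
  by rewrite /layer_avg card_pairs mulrC divfK // gt_eqF.
have F2 x : Fr x ^+ 2 = Fr x by case: (F x); rewrite /= ?expr1n ?expr0n.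
have lhs : \sum_(x : {set P} | #|x| == n)
    avg (fun s => G (permpre s (pick_pt set0)) (permpre s w0) (permpre s x)) =
    2 * C * (alpha * (1 - alpha)).
  rewrite -avg_sum.
  rewrite (eq_avg (h := fun s => (C - 2 * C * alpha)
      * Fr (permpre s (pick_pt set0)) + C * alpha)) => [|s]; last first.
    rewrite (sum_layer_permpre (fun x => (Fr (permpre s (pick_pt set0)) - Fr x) ^+ 2)).
    set f0 := (F _)%:R.
    transitivity (\sum_(x : {set P} | #|x| == n) (f0 + (1 - 2 * f0) * Fr x)).
      apply: eq_bigr => x _; have := F2 x; have : f0 ^+ 2 = f0 by apply: F2.
      by rewrite /G; set r := (F x)%:R => h1 h2; lra.
    rewrite big_split /= -mulr_sumr sumF.
    rewrite sumr_const -cardsE card_draws card_pairs -[f0 *+ _]mulr_natr -/C.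
    by ring.
  rewrite avgD avgZ avg_const ?perm_gt0 //.
  by rewrite (avg_permpre Fr (card_pick_pt _)); ring.
have rhs : \sum_(x : {set P} | #|x| == n)
    avg (fun s => G (permpre s (pick_pt set0)) (permpre s w0) (permpre s x)) =
    \sum_(A : {set 'I_n}) 'C(n, #|A|)%:R * u A.
  rewrite sum_layer_exchange; apply: eq_bigr => A _.
  rewrite (eq_bigr (fun _ => u A)) => [|B /eqP BA].
    rewrite sumr_const -[u A *+ _]mulr_natl; congr (_%:R * _).
    by rewrite -cardsE card_draws card_ord.
  by apply: avg_exchange; rewrite ?BA // -setI_eq0 setI0.
have u0 A : 0 <= u A by apply: avg_ge0 => s; apply: sqr_ge0.
have u_avg : avg u = 2 * avg (fun s =>
    avg (fun b => (subcube s b)%:R ^+ 2 : R)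
    - avg (fun b => (subcube s b)%:R : R) ^+ 2).
  transitivity (avg (fun b => avg (fun b' => avg (fun s =>
     G (permpre s (pick_pt b)) (permpre s w0) (permpre s (pick_pt b')))))).
    rewrite -(avg_const (avg u) (cube_gt0 'I_n)); apply: eq_avg => b.
    rewrite (reindex_avg _ (@symId _ b)); apply: eq_avg => b'.
    by rewrite [RHS]avg_pick_symd.
  under eq_avg => b do rewrite exchange_avg.
  rewrite exchange_avg -avgZ; apply: eq_avg => s.
  set f := subcube s.
  transitivity (avg (fun b => (f b)%:R ^+ 2 +
     (avg (fun b' => (f b')%:R ^+ 2) - 2 * avg (fun b' => (f b')%:R : R) * (f b)%:R) : R)).
    apply: eq_avg => b; rewrite -[(f b)%:R ^+ 2](avg_const _ (cube_gt0 'I_n)).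
    rewrite mulrAC -avgZ -avgB -avgD.
    by apply: eq_avg => b'; rewrite /G -/(subcube s b) -/(subcube s b') -/f; ring.
  by rewrite avgD avgB avgZ avg_const ?cube_gt0 //; ring.
rewrite -u_avg.
have C2 : 0 < 2 * C by rewrite mulr_gt0.
rewrite -(ler_pM2l C2) -lhs rhs /avg mulrA mulrAC mulr_sumr.
apply: ler_sum => A _; rewrite ler_wpM2r //.
rewrite card_cube card_ord ler_pdivlMr ?ltr0n ?expn_gt0 //.
by rewrite mulrC -!natrM ler_nat bin_le_central.
Qed.

End Slice.

(** * Mean influences of the restriction *)

Section SliceInfluence.
Variables (R : realFieldType) (n : nat).
Local Notation P := ('I_n * bool)%type.
Implicit Types (A B K b : {set 'I_n}) (x y z w : {set P}) (s : {perm P}).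
Variable F : {set P} -> bool.

Local Notation Fr := (fun x => (F x)%:R : R).
Local Notation alpha := (layer_avg Fr n).
Local Notation beta := (layer_avg Fr n.+1).

Definition pair_infl k : R := avg (fun s => infl R (subcube F s) k).

Lemma pair_infl_ge0 k : 0 <= pair_infl k.
Proof. by apply: avg_ge0 => s; apply: infl_ge0. Qed.

(** Both ends of an edge in direction [k] lie below the point [z] of the layer [n + 1] containing
    the whole pair. If [F] differs on the edge, it holds at [z] and fails at one end, so the
    indicator is at most the sum of the two increments up to [z]. *)
Lemma slice_energy k : (forall x y, x \subset y -> F x -> F y) ->
  pair_infl k <= 2 * (beta - alpha).
Proof.
move=> Fmono; rewrite /pair_infl /infl exchange_avg.
rewrite -(avg_const (2 * (beta - alpha)) (cube_gt0 'I_n)); apply: ler_avg => b.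
pose z : {set P} := mkset (k |: ~: b) (k |: b).
have zn : #|z| = n.+1.
  rewrite card_mkset !cardsU1 inE.
  by have := cardsC b; rewrite card_ord; case: (k \in b) => /=; lia.
rewrite -(avg_permpre Fr zn) -(avg_permpre Fr (card_pick_pt b)).
have -> : 2 * (avg (fun s => Fr (permpre s z)) - avg (fun s => Fr (permpre s (pick_pt b)))) =
   (avg (fun s => Fr (permpre s z)) - avg (fun s => Fr (permpre s (pick_pt b)))) +
   (avg (fun s => Fr (permpre s z))
     - avg (fun s => Fr (permpre s (pick_pt (symd b [set k]))))).
  rewrite (avg_permpre Fr (card_pick_pt (symd b [set k]))).
  by rewrite (avg_permpre Fr (card_pick_pt b)); ring.
rewrite -!avgB -avgD; apply: ler_avg => s; rewrite /subcube.
have sub1 : pick_pt b \subset z.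
  apply/subsetP=> p; rewrite !in_mkset !inE.
  by case: p.2; move=> ->; rewrite orbT.
have sub2 : pick_pt (symd b [set k]) \subset z.
  apply/subsetP=> p; rewrite !in_mkset !inE.
  by case: p.2; case: (p.1 == k) => //=; rewrite addbF.
have m1 := Fmono _ _ (permpreS s sub1); have m2 := Fmono _ _ (permpreS s sub2).
move: m1 m2; case: (F (permpre s z)); case: (F (permpre s (pick_pt b)));
case: (F (permpre s (pick_pt _))) => //= m1 m2; try lra.
all: try by have := m1 isT.
all: by have := m2 isT.
Qed.

End SliceInfluence.

Lemma sum_avoid (R : realFieldType) (m : nat) (k : 'I_m.+1) (g : nat -> R) :
  \sum_(A : {set 'I_m.+1} | k \notin A) g #|A| =
  \sum_(t < m.+1) 'C(m, t)%:R * g t.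
Proof.
have lt_card (A : {set 'I_m.+1}) : k \notin A -> (#|A| < m.+1)%N.
  move=> kA; rewrite -[X in (_ < X)%N]card_ord -cardsT.
  apply: proper_card; apply/properP; split; first exact: subsetT.
  by exists k; rewrite ?inE.
rewrite (partition_big (fun A : {set 'I_m.+1} => inord #|A| : 'I_m.+1) predT) //=.
apply: eq_bigr => t _.
transitivity (\sum_(A : {set 'I_m.+1} | (A \subset [set~ k]) && (#|A| == t)) g t).
  apply: eq_big => [A|A /andP[kA /eqP <-]]; last by rewrite inordK ?lt_card.
  rewrite subsetC sub1set inE; case: (boolP (k \in A)) => //= kA.
  by rewrite -val_eqE /= inordK ?lt_card.
rewrite sumr_const -[g t *+ _]mulr_natl; congr (_%:R * _).
have cardk : #|[set~ k]| = m by rewrite cardsC1 card_ord.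
by rewrite -[X in 'C(X, _)]cardk -cards_draws; apply: eq_card => A; rewrite !inE.
Qed.

(** * Second moment of the influences of the restriction *)

Section SecondMoment.
Variables (R : realFieldType) (m : nat).
Local Notation n := m.+1.
Local Notation P := ('I_n * bool)%type.
Implicit Types (A B K b : {set 'I_n}) (x y z w : {set P}) (s : {perm P}).
Variable F : {set P} -> bool.

(** Toggling the pair [w] means toggling [v], then [u]; if [F] changes, it changes at one of the two
    steps. The first is seen from the starting point and the second, backwards, from the end point.
    Both range injectively over points of the layer [n], whence the factor 2. *)
Lemma sum_exchange_pivotal (kap : R) (k : 'I_n) s :
  (forall v : P, \sum_(x : {set P} | #|x| == n) (F x != F (symd x [set v]))%:R
                 <= kap) ->
  \sum_(A : {set 'I_n} | k \notin A)
    \sum_(B : {set 'I_n} | (k \notin B) && (#|B| == #|A|))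
      (F (permpre s (mkset (~: B) A))
       != F (symd (permpre s (mkset (~: B) A))
                  (permpre s (mkset [set k] [set k]))))%:R <= 2 * kap.
Proof.
move=> piv; set w := permpre s _.
pose u := (s^-1%g (k, false)); pose v := (s^-1%g (k, true)).
have wE : w = symd [set v] [set u].
  rewrite -!permpre1 -permpre_symd; congr permpre.
  apply/setP=> -[i e]; rewrite in_symd !inE !xpair_eqE.
  by case: e; rewrite /= ?andbT ?andbF ?addbF.
pose h z := (F z != F (symd z [set v]))%:R : R.
pose h' z := (F z != F (symd z [set u]))%:R : R.
pose pt A B := permpre s (mkset (~: B) A).
have ptK A B : symd (pt A B) w = pt (symd A [set k]) (symd B [set k]).
  rewrite /pt /w -permpre_symd; congr permpre.
  apply/setP=> p; rewrite in_symd !inE; case: p.2 => //.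
  by rewrite addNb.
have all_sum (g : {set P} -> R) :
    \sum_(A : {set 'I_n}) \sum_(B : {set 'I_n} | #|B| == #|A|) g (pt A B) =
    \sum_(x : {set P} | #|x| == n) g x.
  by rewrite -(sum_layer_permpre g n s) sum_layer_exchange.
apply: (@le_trans _ _ (\sum_(A : {set 'I_n} | k \notin A)
    \sum_(B : {set 'I_n} | (k \notin B) && (#|B| == #|A|))
      (h (pt A B) + h' (pt (symd A [set k]) (symd B [set k]))))).
  apply: ler_sum => A kA; apply: ler_sum => B /andP[kB AB].
  rewrite -/(pt A B) /h /h' ptK -ptK wE.
  rewrite -symdA symdK.
  by case: (F (pt A B)); case: (F (symd (pt A B) [set v]));
     case: (F (symd _ _)) => /=; lra.
under eq_bigr => A _ do rewrite big_split.
rewrite big_split /= mulr2n mulrDl mul1r; apply: lerD.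
  apply: le_trans (piv v); rewrite -all_sum.
  rewrite big_mkcond /=; apply: ler_sum => A _.
  case: ifP => kA; last by apply: sumr_ge0 => B _; rewrite ler0n.
  rewrite big_mkcondl; apply: ler_sum => B _.
  by case: ifP; rewrite ?ler0n.
apply: le_trans (piv u); rewrite -all_sum.
rewrite [leRHS](reindex_inj (@symdI _ [set k])) /= big_mkcond /=.
apply: ler_sum => A _; case: ifP => kA; last by apply: sumr_ge0 => B _; rewrite ler0n.
rewrite [leRHS](reindex_inj (@symdI _ [set k])) big_mkcond [leRHS]big_mkcond.
apply: ler_sum => B _; case: ifP => [/andP[kB /eqP BA]|_]; last first.
  by case: ifP; rewrite ?ler0n.
have addk (C : {set 'I_n}) : k \notin C -> #|symd C [set k]| = #|C|.+1.
  move=> kC; have -> : symd C [set k] = k |: C.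
    apply/setP=> i; rewrite in_symd !inE; case: eqVneq => [->|_];
    by rewrite ?(negPf kC) ?addbF.
  by rewrite cardsU1 kC.
by rewrite !addk // BA eqxx.
Qed.

(** The second moment is the average over [A] of the probability [u A] that two points differing by
    [A] are both pivotal. Where ['C(m, #|A|)] is at least [th], the uniform weight is at most [lam]
    times the layer weight, and pivotal points of the layer are counted by [kap]. Elsewhere
    [u A <= mu], and [binomial_small_mass] bounds the proportion of such [A]. *)
Lemma slice_second_moment (k : 'I_n) (kap lam : R) (X : nat) :
  0 < lam -> (0 < X)%N -> 
  (forall v : P, \sum_(x : {set P} | #|x| == n) (F x != F (symd x [set v]))%:R
                 <= kap * 'C(n.*2, n)%:R) ->
  avg (fun s => infl R (subcube F s) k ^+ 2) <=
  pair_infl R F k *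
  (8 * lam * kap + m%:R / X%:R ^+ 2
   + X.+1%:R * ('C(m.*2, m)%:R / (4 ^+ m * lam))).
Proof.
move=> lam0 X0 piv.
pose K : {set 'I_n} := [set k].
pose w := mkset K K.
pose H x w := (F x != F (symd x w))%:R : R.
pose G y w x := H y w * H x w.
pose u A := avg (fun s => G (permpre s (pick_pt set0)) (permpre s w)
                            (permpre s (pick_pt A))).
set mu := pair_infl R F k; have mu0 : 0 <= mu by apply: pair_infl_ge0.
have H01 x w' : 0 <= H x w' <= 1 by rewrite /H; case: (_ != _); rewrite ?ler01 ?lexx.
have HE s b : (subcube F s b != subcube F s (symd b [set k]))%:R =
              H (permpre s (pick_pt b)) (permpre s w).
  by rewrite /subcube pick_pt_symd permpre_symd.
have second : avg (fun s => infl R (subcube F s) k ^+ 2) = avg u.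
  transitivity (avg (fun s => avg (fun b => avg (fun b' =>
     G (permpre s (pick_pt b)) (permpre s w) (permpre s (pick_pt b')))))).
    apply: eq_avg => s; rewrite /infl expr2 -avgZ; apply: eq_avg => b.
    by rewrite mulrC -avgZ; apply: eq_avg => b'; rewrite !HE.
  rewrite exchange_avg -(avg_const (avg u) (cube_gt0 'I_n)); apply: eq_avg => b.
  rewrite exchange_avg (reindex_avg _ (@symId _ b)); apply: eq_avg => b'.
  by rewrite avg_pick_symd symKd.
have first : mu = avg (fun s => H (permpre s (pick_pt set0)) (permpre s w)).
  rewrite /mu /pair_infl /infl exchange_avg -[RHS](avg_const _ (cube_gt0 'I_n)).
  apply: eq_avg => b; under eq_avg => s do rewrite HE.
  exact: (avg_pick_symd (fun y w x => H y w) K b b).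
have u_flip A : u (symd A K) = u A.
  apply: eq_avg => s; congr (_ * _); rewrite pick_pt_symd permpre_symd /H symdK.
  by rewrite eq_sym.
have u_le A : u A <= mu.
  rewrite first; apply: ler_avg => s; apply: ler_piMr.
    by case/andP: (H01 (permpre s (pick_pt set0)) (permpre s w)).
  by case/andP: (H01 (permpre s (pick_pt A)) (permpre s w)).
have u_ge0 A : 0 <= u A.
  by apply: avg_ge0 => s; apply: mulr_ge0; apply: ler0n.
pose C : R := 'C(m.*2, m)%:R.
have C0 : 0 < C by rewrite ltr0n bin_gt0; lia.
have two0 : 0 < 2 ^+ m :> R by rewrite exprn_gt0.
(* [u] is invariant under toggling [k], so it suffices to treat the sets avoiding [k], as
   [avg_exchange] requires. *)
have half : avg u = (\sum_(A : {set 'I_n} | k \notin A) u A) / 2 ^+ m.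
  rewrite /avg card_cube card_ord natrX exprS (bigID (fun A : {set 'I_n} => k \in A)) /=.
  rewrite (reindex_inj (@symdI _ K)) /=.
  rewrite (eq_big (fun A : {set 'I_n} => k \notin A) u) => [|A|A _]; first last.
  - exact: u_flip.
  - by rewrite in_symd !inE eqxx addbT.
  by field; rewrite gt_eqF.
have weighted : \sum_(A : {set 'I_n} | k \notin A) 'C(m, #|A|)%:R * u A <=
                mu * (8 * kap * C).
  (* The constant 8 is the 2 of [sum_exchange_pivotal] times the 4 of [central_bin_le4]. *)
  have kap_le : 2 * (kap * 'C(n.*2, n)%:R) <= 8 * kap * C.
    have kap0 : 0 <= kap.
      have := piv (k, true); rewrite -ler_pdivrMr ?ltr0n ?bin_gt0 //; last by lia.
      by apply: le_trans; rewrite divr_ge0 ?ler0n // sumr_ge0.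
    have := central_bin_le4 m; rewrite -(ler_nat R) natrM -/C.
    move/(ler_wpM2l kap0); lra.
  rewrite (eq_bigr (fun A => avg (fun s => H (permpre s (pick_pt set0)) (permpre s w) *
     \sum_(B : {set 'I_n} | (k \notin B) && (#|B| == #|A|))
       H (permpre s (mkset (~: B) A)) (permpre s w)))) => [|A kA].
    rewrite -avg_sum first [leRHS]mulrC -avgZ; apply: ler_avg => s.
    rewrite -mulr_sumr [leRHS]mulrC; apply: ler_wpM2l.
      by case/andP: (H01 (permpre s (pick_pt set0)) (permpre s w)).
    exact: le_trans (sum_exchange_pivotal _ _ piv) kap_le.
  under eq_avg => s do rewrite mulr_sumr.
  rewrite avg_sum (eq_bigr (fun _ => u A)) => [|B /andP[kB /eqP BA]].
    rewrite sumr_const -[u A *+ _]mulr_natl; congr (_%:R * _).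
    have cardk : #|[set~ k]| = m by rewrite cardsC1 card_ord.
    rewrite -[X in 'C(X, _)]cardk -cards_draws; apply: eq_card => B; rewrite !inE.
    by rewrite subsetC sub1set inE.
  by apply: (avg_exchange G); rewrite ?BA // disjoint_sym disjoints1.
pose th : R := C / (2 ^+ m * lam).
have th0 : 0 <= th by rewrite divr_ge0 ?mulr_ge0 ?ltW.
rewrite second half ler_pdivrMr //.
have split_le A : u A <= 2 ^+ m * lam / C * ('C(m, #|A|)%:R * u A)
                        + mu * ('C(m, #|A|)%:R < th)%R%:R.
  have q0 : 0 <= 2 ^+ m * lam / C * ('C(m, #|A|)%:R * u A).
    apply: mulr_ge0; last exact: mulr_ge0 (ler0n _ _) (u_ge0 A).
    by apply: divr_ge0 (ltW C0); apply: mulr_ge0; apply: ltW.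
  case: ltP => h; first by rewrite mulr1 ler_wpDl.
  rewrite mulr0 addr0 mulrA ler_peMl //.
  by move: h; rewrite /th ler_pdivrMr ?mulr_gt0 // mulrAC ler_pdivlMr // mul1r mulrC.
apply: le_trans (ler_sum _ (fun A _ => split_le A)) _.
rewrite big_split /= -!mulr_sumr.
rewrite (sum_avoid k (fun t => ('C(m, t)%:R < th)%R%:R)).
have -> : \sum_(t < m.+1) 'C(m, t)%:R * ('C(m, t)%:R < th)%R%:R =
          \sum_(t < m.+1 | 'C(m, t)%:R < th) 'C(m, t)%:R :> R.
  by rewrite [RHS]big_mkcond; apply: eq_bigr => t _; case: ifP; rewrite ?mulr1 ?mulr0.
have small := ler_wpM2l mu0 (binomial_small_mass m X0 th0).
have big := ler_wpM2l (_ : 0 <= 2 ^+ m * lam / C) weighted.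
have {}big := big (divr_ge0 (mulr_ge0 (ltW two0) (ltW lam0)) (ltW C0)).
apply: le_trans (lerD big small) _.
rewrite le_eqVlt; apply/orP; left; apply/eqP; rewrite /th.
have -> : 4 ^+ m = 2 ^+ m * 2 ^+ m :> R by rewrite -exprMn -natrM.
by field; rewrite !gt_eqF // ltr0n.
Qed.

End SecondMoment.

Lemma ex_approx_sqrt (n : nat) : (0 < n)%N ->
  exists2 s : nat, (n <= s ^ 2)%N & (s ^ 2 <= 4 * n)%N.
Proof.
move=> n0; have ex : exists s, (n <= s ^ 2)%N by exists n; nia.
case: (ex_minnP ex) => s ns smin; exists s => //.
have [s1|s1] := leqP s 1; first by nia.
case: (leqP n (s.-1 ^ 2)) => h; first by have := smin _ h; lia.
by nia.
Qed.

(** * The KKL inequality for the random restriction *)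

Section SliceKKL.
Variables (R : realFieldType) (m : nat).
Local Notation n := m.+1.
Local Notation P := ('I_n * bool)%type.
Variable F : {set P} -> bool.
Local Notation Fr := (fun x => (F x)%:R : R).
Local Notation alpha := (layer_avg Fr n).
Local Notation beta := (layer_avg Fr n.+1).

(* With [q = 3 ^ d], the second moment bound is used for [lam = q ^ 6] and
   [X ~ q ^ 2 * r], so that each of its three terms is [O(q ^- 4)]. *)
Lemma slice_kkl (d : nat) (r : R) :
  0 < r -> r ^+ 2 = n%:R -> (3 ^ (20 * d) <= n)%N ->
  (forall x y : {set P}, x \subset y -> F x -> F y) ->
  (forall v : P, \sum_(x : {set P} | #|x| == n) (F x != F (symd x [set v]))%:R
                 <= 4 / r * 'C(n.*2, n)%:R) ->
  alpha * (1 - alpha) * d.+1%:R <= 154 * n%:R * (beta - alpha).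
Proof.
move=> r0 r2 dn Fmono piv.
have [q qE] : exists q : R, q = 3 ^+ d by exists (3 ^+ d).
have d0 : 0 < d.+1%:R :> R by rewrite ltr0n.
have q_d : d.+1%:R <= q by rewrite qE -natrX ler_nat ltn_expl.
have q0 : 0 < q by apply: lt_le_trans q_d.
(* The hypothesis on [d] reads [q ^+ 20 <= n]. *)
have qr : q ^+ 10 <= r.
  rewrite -ler_sqr ?nnegrE ?exprn_ge0 ?(ltW q0) ?(ltW r0) // r2 qE -!exprM -natrX.
  by rewrite ler_nat (_ : (d * 10 * 2 = 20 * d)%N) // -mulnA mulnC.
have [s ns sn] := ex_approx_sqrt (ltn0Sn m).
have s0 : (0 < s)%N by case: s ns {sn} => //.
have sR : s%:R <= 2 * r.
  rewrite -ler_sqr ?nnegrE ?mulr_ge0 ?ler0n ?(ltW r0) // exprMn r2 -!natrX -natrM.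
  by rewrite ler_nat.
have sR2 : m%:R <= s%:R ^+ 2 :> R by rewrite -natrX ler_nat ltnW.
have central : 'C(m.*2, m)%:R / 4 ^+ m <= r^-1.
  rewrite -ler_sqr ?nnegrE ?divr_ge0 ?ler0n ?exprn_ge0 ?invr_ge0 ?(ltW r0) //.
  rewrite exprMn -!exprVn [leRHS]exprVn r2 -exprM mulnC exprM exprVn.
  rewrite (_ : 4 ^+ 2 = 16 :> R); last by rewrite -natrX.
  rewrite exprVn ler_pdivrMr ?exprn_gt0 // ler_pdivlMl ?ltr0n //.
  rewrite -!natrX -natrM ler_nat; apply: leq_trans (central_bin_upper m).
  by rewrite mulnC leq_mul2l; apply/orP; right; lia.
pose X := (s * 3 ^ (2 * d))%N.
have X0 : (0 < X)%N by rewrite muln_gt0 s0 expn_gt0.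
have XR : X%:R = s%:R * q ^+ 2 :> R by rewrite natrM natrX qE -exprM [(d * 2)%N]mulnC.
have lam0 : 0 < q ^+ 6 by rewrite exprn_gt0.
set E := 8 * q ^+ 6 * (4 / r) + m%:R / X%:R ^+ 2
   + X.+1%:R * ('C(m.*2, m)%:R / (4 ^+ m * q ^+ 6)).
(* The three terms contribute 32, 1 and 4. *)
have EB : E <= 37 / q ^+ 4.
  have q4 : 0 < q ^+ 4 by rewrite exprn_gt0.
  have t1 : 8 * q ^+ 6 * (4 / r) <= 32 / q ^+ 4.
    have -> : 8 * q ^+ 6 * (4 / r) = 32 * (q ^+ 6 / r) by field; rewrite gt_eqF.
    by rewrite ler_pM2l // ler_pdivrMr // ler_pdivlMl // -exprD.
  have t2 : m%:R / X%:R ^+ 2 <= (q ^+ 4)^-1.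
    rewrite XR ler_pdivrMr; last by rewrite exprn_gt0 // mulr_gt0 ?ltr0n ?exprn_gt0.
    by rewrite exprMn -exprM mulrCA mulVf ?gt_eqF // mulr1.
  have t3 : X.+1%:R * ('C(m.*2, m)%:R / (4 ^+ m * q ^+ 6)) <= 4 / q ^+ 4.
    have X2 : X.+1%:R <= 4 * r * q ^+ 2.
      have : X.+1%:R <= 2 * X%:R :> R by rewrite -natrM ler_nat; lia.
      move/le_trans; apply; rewrite XR.
      by have := ler_wpM2r (exprn_ge0 2 (ltW q0)) sR; lra.
    have e : 4 / q ^+ 4 = 4 * r * q ^+ 2 * (r^-1 / q ^+ 6).
      by field; rewrite !gt_eqF.
    rewrite e invfM; apply: ler_pM => //; rewrite mulrA.
      by rewrite divr_ge0 ?(ltW lam0) // divr_ge0 ?ler0n ?exprn_ge0.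
    by rewrite ler_wpM2r // invr_ge0 (ltW lam0).
  by rewrite /E; lra.
pose mu k := pair_infl R F k.
have mu0 k : 0 <= mu k by apply: pair_infl_ge0.
have moment k : avg (fun u => infl R (subcube F u) k ^+ 2) <= mu k * (37 / q ^+ 4).
  apply: le_trans (slice_second_moment k lam0 X0 piv) _.
  exact: ler_wpM2l.
have qV : 0 < (q ^+ 2)^-1 by rewrite invr_gt0 exprn_gt0.
(* [variance_le] with [s = q ^- 2], for which both hypercontractive terms are [O(1 / q)] on average.
   The constant 77 bounds [2 * (1 / 4 + 1 + 37)], since [q^-1 <= 1 / (d + 1)]. *)
have var : alpha * (1 - alpha) <= 77 / d.+1%:R * \sum_k mu k.
  apply: le_trans (slice_variance R F (ltn0Sn m)) _.
  apply: le_trans (_ : 2 * avg (fun u => \sum_k (infl R (subcube F u) k / (4 * d.+1%:R)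
     + 3 ^+ d * ((q ^+ 2)^-1 * infl R (subcube F u) k
                 + infl R (subcube F u) k ^+ 2 / (q ^+ 2)^-1))) <= _).
    by rewrite ler_pM2l //; apply: ler_avg => u; apply: variance_le.
  rewrite avg_sum !mulr_sumr; apply: ler_sum => k _; rewrite -qE.
  rewrite (eq_avg (h := fun u => ((4 * d.+1%:R)^-1 + q * (q ^+ 2)^-1)
      * infl R (subcube F u) k + (q * q ^+ 2) * infl R (subcube F u) k ^+ 2)); last first.
    by move=> u; rewrite invrK; ring.
  rewrite avgD !avgZ -/(mu k).
  have qd : q^-1 <= d.+1%:R^-1 by rewrite lef_pV2 ?posrE.
  have h := ler_wpM2l (mulr_ge0 (ltW q0) (exprn_ge0 2 (ltW q0))) (moment k).
  apply: le_trans (_ : 2 * (((4 * d.+1%:R)^-1 + q * (q ^+ 2)^-1) * mu k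
     + q * q ^+ 2 * (mu k * (37 / q ^+ 4))) <= _).
    by rewrite ler_pM2l // lerD2l.
  have -> : 2 * (((4 * d.+1%:R)^-1 + q * (q ^+ 2)^-1) * mu k
     + q * q ^+ 2 * (mu k * (37 / q ^+ 4))) =
     (d.+1%:R^-1 / 2 + 76 * q^-1) * mu k.
    by field; rewrite nat1r !gt_eqF.
  rewrite ler_wpM2r //; have : 0 < d.+1%:R^-1 :> R by rewrite invr_gt0.
  by move: qd; move: (q^-1) (d.+1%:R^-1) => x y; lra.
have sum_mu : \sum_k mu k <= n%:R * (2 * (beta - alpha)).
  rewrite -[n in n%:R]card_ord mulr_natl -sumr_const.
  by apply: ler_sum => k _; apply: slice_energy.
rewrite -ler_pdivlMr //; apply: le_trans var _.
have -> : 154 * n%:R * (beta - alpha) / d.+1%:R =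
  77 / d.+1%:R * (n%:R * (2 * (beta - alpha))) by ring.
by rewrite ler_wpM2l // divr_ge0 ?ler0n.
Qed.

End SliceKKL.

(** * Sequences of layer densities *)

Lemma half_central_bin j : (0 < j)%N -> (2 * 'C(j.*2, j) <= 2 ^ j.*2)%N.
Proof.
move=> j0; rewrite -leq_sqr expnMn -!expnM.
rewrite (_ : (j.*2 * 2 = 4 * j)%N); last by lia.
rewrite (expnM 2 4) (_ : (2 ^ 4 = 16)%N) //.
apply: leq_trans (central_bin_upper j); rewrite [leqRHS]mulnC leq_mul2r.
by apply/orP; right; rewrite (_ : (2 ^ 2 = 4)%N) //; lia.
Qed.

Lemma central_bin_sum n : (\sum_(i < n.+1) 'C(n, i) ^ 2)%N = 'C(n.*2, n).
Proof.
rewrite -addnn -binomial.Vandermonde; apply: eq_bigr => i _.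
by rewrite bin_sub ?mulnn // -ltnS.
Qed.

Section LayerSequence.
Variables (R : realFieldType) (n : nat).
Implicit Types (a g : nat -> R).

Local Notation S g := (\sum_(i < n.+1) 'C(n, i)%:R * g (nat_of_ord i)).

Lemma sum_bin_rev g : S g = S (fun i => g (n - i)%N).
Proof.
rewrite (reindex_inj rev_ord_inj); apply: eq_bigr => i _ /=.
by rewrite subSS bin_sub // -ltnS.
Qed.

Definition upper_half (i : nat) : R := (n < i.*2)%N%:R.

Hypothesis n0 : (0 < n)%N.

(** By the reflection [i -> n - i], twice this mass is the total minus the middle layer, which is at
    most half of the total. *)
Lemma upper_half_mass :
  2 ^+ n / 4 <= S upper_half /\ S upper_half <= 2 ^+ n / 2.
Proof.
have twice : 2 * S upper_half = 2 ^+ n - \sum_(i < n.+1) 'C(n, i)%:R * (i.*2 == n)%:R.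
  rewrite mulr_natl mulr2n {2}sum_bin_rev -big_split -sum_bin_natr -sumrB /=.
  apply: eq_bigr => i _; rewrite -mulrDr.
  rewrite [RHS](_ : _ = 'C(n, i)%:R * (1 - (i.*2 == n)%:R)); last by ring.
  congr (_ * _); have := ltn_ord i; rewrite /upper_half => hi.
  have -> : (n < (n - i).*2)%N = (i.*2 < n)%N by lia.
  by case: (ltngtP n i.*2) => _ /=; lra.
have center0 : 0 <= \sum_(i < n.+1) 'C(n, i)%:R * (i.*2 == n)%:R :> R.
  by apply: sumr_ge0 => i _; rewrite mulr_ge0 ?ler0n.
have center : 2 * \sum_(i < n.+1) 'C(n, i)%:R * (i.*2 == n)%:R <= 2 ^+ n :> R.
  have [en|en] := eqVneq n./2.*2 n; last first.
    rewrite big1 ?mulr0 ?exprn_ge0 // => i _.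
    have -> : (i.*2 == n) = false; last by rewrite mulr0.
    by apply: contra_neqF en => /eqP <-; rewrite doubleK.
  have hn : (n./2 < n.+1)%N by lia.
  rewrite (bigD1 (Ordinal hn)) //= big1 => [|i ih].
    rewrite en eqxx mulr1 addr0 -natrX -natrM ler_nat.
    by rewrite -[in X in 'C(X, _)]en -[in leqRHS]en half_central_bin //; lia.
  have -> : (i.*2 == n) = false; last by rewrite mulr0.
  by apply: contra_neqF ih => /eqP e; apply/val_inj; rewrite /= -[LHS]doubleK e.
by split; lra.
Qed.

Variable a : nat -> R.
Hypothesis a_mono : forall i j, (i <= j <= n)%N -> a i <= a j.
Hypothesis a01 : forall i, (i <= n)%N -> 0 <= a i <= 1.
Local Notation c0 := (a n./2).
Local Notation D := (S (fun i => `|a i - c0|)).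

(** The weights [2 ^+ n * upper_half i - M] have total mass 0, so [a] may be centred at [c0]. They
    then have the sign of [a i - c0] by monotonicity, and absolute value at least [2 ^+ n / 4]. *)
Lemma dev_le_cov :
  2 ^+ n * D <= 4 * (2 ^+ n * S (fun i => a i * upper_half i) - S a * S upper_half).
Proof.
have [M ME] : exists M, M = S upper_half by exists (S upper_half).
have [lo hi] := upper_half_mass; rewrite -!ME in lo hi *.
have -> : 2 ^+ n * S (fun i => a i * upper_half i) - S a * M =
  S (fun i => (a i - c0) * (2 ^+ n * upper_half i - M)).
  have -> : S (fun i => (a i - c0) * (2 ^+ n * upper_half i - M)) =
     2 ^+ n * S (fun i => a i * upper_half i) - S a * M
     - c0 * (2 ^+ n * S upper_half - \sum_(i < n.+1) 'C(n, i)%:R * M).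
    rewrite !mulr_sumr mulr_suml -!sumrB mulr_sumr -sumrB.
    by apply: eq_bigr => i _; ring.
  by rewrite -mulr_suml sum_bin_natr -ME subrr mulr0 subr0.
rewrite !mulr_sumr; apply: ler_sum => i _.
rewrite mulrCA [leRHS]mulrCA ler_wpM2l ?ler0n //.
have i_n : (i <= n)%N by rewrite -ltnS.
have P0 : 0 <= 2 ^+ n :> R by rewrite exprn_ge0.
rewrite /upper_half; case: ltnP => hi2 /=.
  have ac : 0 <= a i - c0 by rewrite subr_ge0 a_mono //; lia.
  rewrite ger0_norm // mulr1; have := mulr_ge0 ac P0; have := ler_wpM2l ac hi; lra.
have ac : 0 <= c0 - a i by rewrite subr_ge0 a_mono //; lia.
rewrite -normrN opprB ger0_norm // mulr0; have := mulr_ge0 ac P0; have := ler_wpM2l ac lo; lra.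
Qed.

(** One of [i] and [n - i] is at least [n./2], so [a i + a (n - i) >= c0]; the squared binomial
    weights are symmetric. With [central_avg_upper] this keeps [alpha] away from 0 and 1. *)
Lemma central_avg_lower :
  c0 * 'C(n.*2, n)%:R <= 2 * S (fun i => 'C(n, i)%:R * a i).
Proof.
rewrite mulr_natl mulr2n {2}(sum_bin_rev (fun i => 'C(n, i)%:R * a i)) -big_split /=.
rewrite -central_bin_sum natr_sum mulr_sumr; apply: ler_sum => i _.
have i_n : (i <= n)%N by rewrite -ltnS.
rewrite bin_sub // natrX -mulrDr -mulrDr mulrA -expr2 mulrC.
rewrite ler_wpM2l ?sqr_ge0 //.
have /andP[ai0 _] := a01 i_n; have /andP[an0 _] := a01 (leq_subr i n).
have [h|h] := leqP i.*2 n.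
  by have : c0 <= a (n - i)%N by [apply: a_mono; lia]; lra.
by have : c0 <= a i by [apply: a_mono; lia]; lra.
Qed.

Lemma central_avg_upper :
  (1 - c0) * 'C(n.*2, n)%:R <=
  2 * ('C(n.*2, n)%:R - S (fun i => 'C(n, i)%:R * a i)).
Proof.
have -> : 2 * ('C(n.*2, n)%:R - S (fun i => 'C(n, i)%:R * a i)) =
    2 * S (fun i => 'C(n, i)%:R * (1 - a i)).
  rewrite -central_bin_sum natr_sum -sumrB; congr (_ * _).
  by apply: eq_bigr => i _; rewrite natrX; ring.
rewrite mulr_natl mulr2n {2}(sum_bin_rev (fun i => 'C(n, i)%:R * (1 - a i))) -big_split /=.
rewrite -[X in _ * X%:R]central_bin_sum natr_sum mulr_sumr; apply: ler_sum => i _.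
have i_n : (i <= n)%N by rewrite -ltnS.
rewrite bin_sub // natrX -mulrDr -mulrDr mulrA -expr2 mulrC.
rewrite ler_wpM2l ?sqr_ge0 //.
have /andP[_ ai1] := a01 i_n; have /andP[_ an1] := a01 (leq_subr i n).
have [h|h] := leqP i.*2 n.
  by have : a i <= c0 by [apply: a_mono; lia]; lra.
by have : a (n - i)%N <= c0 by [apply: a_mono; lia]; lra.
Qed.

(** Equal to ['C(n, n + 1 - i)] for [i <= n]: the number of ways to complete an [i]-set to the layer
    [n + 1] by dummy coordinates. The value 0 at [i = 0] reflects that there are only [n] of
    them. *)
Definition bin_pred (i : nat) : nat := if i is j.+1 then 'C(n, j) else 0.

(** The mass given to one point of weight [i] by the projection of the layer [n + 1], minus that
    given by the projection of the layer [n]. *)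
Definition layer_jump (i : nat) : R :=
  (bin_pred i)%:R / 'C(n.*2, n.+1)%:R - 'C(n, i)%:R / 'C(n.*2, n)%:R.

(** Both projections are probability measures, by Vandermonde's identity. *)
Lemma sum_layer_jump : S layer_jump = 0.
Proof.
have Cn : 'C(n.*2, n)%:R != 0 :> R by rewrite pnatr_eq0 -lt0n bin_gt0; lia.
have Cn1 : 'C(n.*2, n.+1)%:R != 0 :> R by rewrite pnatr_eq0 -lt0n bin_gt0; lia.
under eq_bigr => i _ do rewrite mulrBr !mulrA -!natrM.
rewrite sumrB -!mulr_suml -!natr_sum.
have -> : (\sum_(i < n.+1) 'C(n, i) * 'C(n, i))%N = 'C(n.*2, n).
  by rewrite -central_bin_sum; apply: eq_bigr => i _; rewrite mulnn.
have -> : (\sum_(i < n.+1) 'C(n, i) * bin_pred i)%N = 'C(n.*2, n.+1).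
  rewrite -addnn -binomial.Vandermonde [RHS]big_ord_recl /= subn0.
  rewrite (@bin_small n n.+1) // muln0 add0n big_ord_recl /= muln0 add0n.
  rewrite [RHS]big_ord_recr /= /bump /= (@bin_small n (1 + n)) // mul0n addn0.
  apply: eq_bigr => i _; rewrite add1n subSS; congr (_ * _)%N.
  by rewrite bin_sub // ltnW.
by rewrite !divff // subrr.
Qed.

(** Over the common denominator [n * 'C(2n, n)] the numerator is
    [(2i - n - 1) * 'C(n + 1, i) + 'C(n, i)], at most [3 * 2 ^+ n] in absolute value by
    [bin_dist_center_abs]. The lower bound on the central coefficient concludes. *)
Lemma layer_jump_le (r : R) i : 0 < r -> r ^+ 2 = n%:R -> (i <= n)%N ->
  `|layer_jump i| * 2 ^+ n <= 6 / r.
Proof.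
move=> r0 r2 i_n.
have N0 : 0 < n%:R :> R by rewrite ltr0n.
set C := 'C(n.*2, n)%:R : R.
have C0 : 0 < C by rewrite ltr0n bin_gt0; lia.
have C1 : 'C(n.*2, n.+1)%:R * n.+1%:R = n%:R * C.
  by rewrite -!natrM mulnC mul_bin_left; congr (_ * _)%:R; lia.
have C1n0 : 'C(n.*2, n.+1)%:R != 0 :> R by rewrite pnatr_eq0 -lt0n bin_gt0; lia.
have jumpE : layer_jump i * (n%:R * C) =
    (i.*2%:R - n.+1%:R) * 'C(n.+1, i)%:R + 'C(n, i)%:R.
  have -> : layer_jump i * (n%:R * C) = (bin_pred i)%:R * n.+1%:R - 'C(n, i)%:R * n%:R.
    rewrite /layer_jump -/C mulrBl -{1}C1.
    congr (_ - _); first by rewrite mulrA divfK.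
    by rewrite mulrCA divfK ?gt_eqF // mulrC.
  have e1 : (bin_pred i)%:R * n.+1%:R = i%:R * 'C(n.+1, i)%:R :> R.
    rewrite -!natrM; case: i {i_n} => [|j]; first by rewrite /= !mul0n.
    by rewrite -mul_bin_diag mulnC.
  have e2 : n.+1%:R * 'C(n, i)%:R = (n.+1%:R - i%:R) * 'C(n.+1, i)%:R :> R.
    by rewrite -natrB ?(leqW i_n) // -!natrM -mul_bin_down.
  rewrite e1 -addnn natrD; move: e2; rewrite -[n.+1%:R]natr1; lra.
have jump_le : `|layer_jump i| * (n%:R * C) <= 3 * 2 ^+ n.
  rewrite -[n%:R * C]ger0_norm ?mulr_ge0 ?ler0n ?(ltW C0) // -normrM jumpE.
  apply: le_trans (ler_normD _ _) _; rewrite normrM !normr_nat.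
  have h1 : `|i.*2%:R - n.+1%:R| * 'C(n.+1, i)%:R <= 2 ^+ n.+1 :> R.
    apply: le_trans (_ : ((n.+1 - i.*2 + (i.*2 - n.+1)) * 'C(n.+1, i))%:R <= _).
      rewrite natrM ler_wpM2r ?ler0n // natrD.
      have [h|h] := leqP i.*2 n.+1.
        by rewrite distrC ger0_norm ?subr_ge0 ?ler_nat // natrB // lerDl ler0n.
      rewrite ger0_norm ?subr_ge0 ?ler_nat ?(ltnW h) //.
      by rewrite -natrB ?(ltnW h) // lerDr ler0n.
    by rewrite -natrX ler_nat bin_dist_center_abs.
  have h2 : 'C(n, i)%:R <= 2 ^+ n :> R.
    rewrite -sum_bin_natr -natr_sum ler_nat (bigD1 (inord i : 'I_n.+1)) //=.
    by rewrite inordK // leq_addr.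
  by move: h1; rewrite exprS; lra.
have C_lower : 4 ^+ n <= 2 * r * C.
  rewrite -ler_sqr ?nnegrE ?exprn_ge0 ?mulr_ge0 ?(ltW r0) ?(ltW C0) //.
  rewrite -exprM mulnC exprM (_ : 4 ^+ 2 = 16 :> R); last by rewrite -natrX.
  have := central_bin_lower n0; rewrite -(ler_nat R) !natrX !natrM -/C => h.
  apply: le_trans h _; rewrite -r2 le_eqVlt; apply/orP; left; apply/eqP; ring.
have rC : 0 < r ^+ 2 * C by rewrite mulr_gt0 // exprn_gt0.
rewrite -(ler_pM2r rC).
have -> : 6 / r * (r ^+ 2 * C) = 3 * (2 * r * C) by field; rewrite gt_eqF.
apply: le_trans (_ : 3 * 4 ^+ n <= _); last by rewrite ler_pM2l.
rewrite r2 mulrAC.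
have -> : 4 ^+ n = 2 ^+ n * 2 ^+ n :> R by rewrite -exprMn -natrM.
by rewrite [leRHS]mulrA ler_wpM2r // exprn_ge0.
Qed.

(** Since the jumps sum to 0, [a] can be centred at [c0] before bounding each jump. *)
Lemma jump_le_dev (r : R) : 0 < r -> r ^+ 2 = n%:R ->
  2 ^+ n * S (fun i => layer_jump i * a i) <= 6 / r * D.
Proof.
move=> r0 r2.
have -> : S (fun i => layer_jump i * a i) = S (fun i => layer_jump i * (a i - c0)).
  transitivity (S (fun i => layer_jump i * a i) - c0 * S layer_jump).
    by rewrite sum_layer_jump mulr0 subr0.
  by rewrite mulr_sumr -sumrB; apply: eq_bigr => i _; ring.
rewrite !mulr_sumr; apply: ler_sum => i _.
rewrite mulrCA [leRHS]mulrCA ler_wpM2l ?ler0n // mulrA.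
apply: le_trans (ler_norm _) _; rewrite normrM ler_wpM2r ?normr_ge0 //.
rewrite normrM [leLHS]mulrC [`|2 ^+ n|]ger0_norm ?exprn_ge0 //.
by apply: layer_jump_le => //; rewrite -ltnS.
Qed.

Lemma dev_ge_mean : `|S a - c0 * 2 ^+ n| <= D.
Proof.
rewrite -sum_bin_natr mulr_sumr -sumrB; apply: le_trans (ler_norm_sum _ _ _) _.
apply: ler_sum => i _.
have -> : 'C(n, i)%:R * a i - c0 * 'C(n, i)%:R = 'C(n, i)%:R * (a i - c0) by ring.
by rewrite normrM normr_nat.
Qed.

End LayerSequence.

(** * The extended family *)

Section Family.
Variables (R : realType) (n : nat) (A : {set Omega n}).
Implicit Types (U V : {set 'I_n}).

Definition indpt U : Omega n := [ffun i => i \in U].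

Definition memA U : bool := indpt U \in A.

Local Notation fr := (fun U => (memA U)%:R : R).

Lemma sum_Omega (g : Omega n -> R) : \sum_x g x = \sum_U g (indpt U).
Proof.
rewrite (reindex indpt) //; exists (fun x : Omega n => [set i | x i]) => [U _|x _].
  by apply/setP=> i; rewrite inE ffunE.
by apply/ffunP=> i; rewrite ffunE inE.
Qed.

Lemma card_Omega : #|{: Omega n}| = #|{set 'I_n}|.
Proof. by rewrite card_cube card_ffun card_bool card_ord. Qed.

Lemma mu_avg (B : {set Omega n}) : mu R B = avg (fun U => (indpt U \in B)%:R : R).
Proof.
rewrite /mu /avg card_Omega -(sum_Omega (fun x => (x \in B)%:R)).
by rewrite -sum1_card natr_sum big_mkcond; congr (_ / _); apply: eq_bigr => x _; case: ifP.
Qed.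

Lemma expect_avg (u : Omega n -> R) : expect u = avg (fun U => u (indpt U)).
Proof.
rewrite /expect /avg -(sum_Omega u) -card_Omega mulr_suml.
by apply: eq_bigr => x _; rewrite /mu cards1 mul1r.
Qed.

Lemma flip_indpt k U : flip k (indpt U) = indpt (symd U [set k]).
Proof.
apply/ffunP=> i; rewrite !ffunE in_symd inE.
by case: eqVneq => _; rewrite ?addbT ?addbF.
Qed.

Lemma infl_influence k : infl R memA k = influence R k A.
Proof.
rewrite /influence mu_avg mulr_natl mulr2n.
rewrite [X in _ = X + _](reindex_avg _ (@symdI _ [set k])) -avgD; apply: eq_avg => U.
rewrite !inE !flip_indpt symdK -/(memA (symd U [set k])) -/(memA U).
by case: (memA U); case: (memA _) => /=; lra.
Qed.

Hypothesis Ainc : increasing A.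

Lemma memA_mono U V : U \subset V -> memA U -> memA V.
Proof.
move=> /subsetP UV UA; apply: (Ainc UA) => i.
by rewrite !ffunE; apply/implyP; apply: UV.
Qed.

(** When [k] is in [U] the character is -1 and monotonicity makes the half difference nonnegative;
    otherwise both signs are reversed. Each pivotal point thus contributes [- 1 / 2]. *)
Lemma fourier1_infl k : fourier fr [set k] = - (infl R memA k / 2).
Proof.
transitivity (fourier (half_diff k fr) [set k]).
  by rewrite fourier_half_diff inE eqxx mul1r.
rewrite /infl [_ / 2]mulrC -mulNr -avgZ; apply: eq_avg => U.
rewrite chiC chi1 /half_diff.
have [kU|kU] := boolP (k \in U).
  have sub : symd U [set k] \subset U.
    apply/subsetP=> i; rewrite in_symd inE; case: eqVneq => [->|_] //.
    by rewrite addbF.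
  have := memA_mono sub.
  by case: (memA U); case: (memA _) => //= h; rewrite ?expr1; try lra; have := h isT.
have sub : U \subset symd U [set k].
  apply/subsetP=> i iU; rewrite in_symd iU inE; case: eqVneq => // ik.
  by rewrite -ik iU in kU.
have := memA_mono sub.
by case: (memA U); case: (memA _) => //= h; rewrite ?expr0; try lra; have := h isT.
Qed.

Lemma sum_infl_sqr : \sum_k infl R memA k ^+ 2 <= 4.
Proof.
apply: (@le_trans _ _ (4 * \sum_S fourier fr S ^+ 2)); last first.
  rewrite -parseval -[leRHS]mulr1 ler_pM2l //.
  rewrite -[leRHS](avg_const 1 (cube_gt0 'I_n)).
  by apply: ler_avg => U; case: (memA U); rewrite ?expr1n ?expr0n.
have -> : \sum_k infl R memA k ^+ 2 = 4 * \sum_k fourier fr [set k] ^+ 2.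
  by rewrite mulr_sumr; apply: eq_bigr => k _; rewrite fourier1_infl; field.
rewrite ler_pM2l //.
have -> : \sum_k fourier fr [set k] ^+ 2 =
          \sum_(S in [set [set k] | k : 'I_n]) fourier fr S ^+ 2.
  rewrite big_imset /=; last by move=> i j _ _ /set1_inj.
  by apply: eq_bigl => k; rewrite inE.
by rewrite big_mkcond; apply: ler_sum => S _; case: ifP => // _; apply: sqr_ge0.
Qed.

Definition ext_memA (x : {set 'I_n * bool}) : bool := memA (fstset x).

Local Notation Fr := (fun x => (ext_memA x)%:R : R).

Lemma ext_memA_mono (x y : {set 'I_n * bool}) :
  x \subset y -> ext_memA x -> ext_memA y.
Proof.
move=> /subsetP xy; apply: memA_mono; apply/subsetP=> i; rewrite !inE.
exact: xy.
Qed.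

(** The last factor counts the dummy parts completing [U] to size [j]; the guard is needed because
    natural subtraction truncates. *)
Lemma sum_layer_fst (g : {set 'I_n} -> R) (j : nat) :
  \sum_(x : {set 'I_n * bool} | #|x| == j) g (fstset x) =
  \sum_U g U * (if #|U| <= j then 'C(n, j - #|U|) else 0)%N%:R.
Proof.
rewrite big_mkcond sum_mkset; apply: eq_bigr => U _.
under eq_bigr => V _ do rewrite fst_mkset card_mkset.
rewrite -big_mkcond sumr_const -[g U *+ _]mulr_natr; congr (_ * _%:R).
case: leqP => h.
  rewrite -[X in 'C(X, _)]card_ord -card_draws; apply: eq_card => V.
  by rewrite inE unfold_in eqnE; move: #|U| #|V| h => u v h; apply/eqP/eqP; lia.
by apply: eq_card0 => V; rewrite unfold_in eqnE; move: #|U| #|V| h => u v h; apply/negbTE/eqP; lia.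
Qed.

(** For an original coordinate, [bin_le_central] bounds the density of the projected layer, and the
    influence bounds the pivotal points. Toggling a dummy coordinate never changes the extended
    family. *)
Lemma pivotal_count (v : 'I_n * bool) (c : R) : (0 < n)%N ->
  (forall k, infl R memA k <= c) ->
  \sum_(x : {set 'I_n * bool} | #|x| == n)
    (ext_memA x != ext_memA (symd x [set v]))%:R <= 2 * c * 'C(n.*2, n)%:R.
Proof.
move=> n0 infl_le; have P0 : 0 < 2 ^+ n :> R by rewrite exprn_gt0.
have c0 : 0 <= c by apply: le_trans (infl_le (Ordinal n0)); apply: infl_ge0.
case: v => k [].
  have fstE x : fstset (symd x [set (k, true)]) = symd (fstset x) [set k].
    by apply/setP=> i; rewrite in_symd !inE xpair_eqE eqxx andbT.
  under eq_bigr => x _ do rewrite /ext_memA fstE.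
  rewrite (sum_layer_fst (fun U => (memA U != memA (symd U [set k]))%:R)).
  have -> : 2 * c * 'C(n.*2, n)%:R = c * (2 ^+ n * (2 * 'C(n.*2, n)%:R / 2 ^+ n)).
    by field; rewrite gt_eqF.
  apply: le_trans (_ : \sum_U (memA U != memA (symd U [set k]))%:R *
      (2 * 'C(n.*2, n)%:R / 2 ^+ n) <= _).
    apply: ler_sum => U _; rewrite ler_wpM2l ?ler0n // ler_pdivlMr //.
    rewrite mulrC -natrX -!natrM ler_nat; case: ifP => _; last by rewrite muln0.
    exact: bin_le_central.
  rewrite -mulr_suml [leRHS]mulrA; apply: ler_wpM2r.
    by rewrite divr_ge0 ?(ltW P0) // mulr_ge0 ?ler0n.
  have := infl_le k; rewrite /infl /avg card_cube card_ord natrX.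
  by rewrite ler_pdivrMr.
rewrite big1 ?mulr_ge0 ?ler0n // => x _.
rewrite /ext_memA (_ : fstset (symd x _) = fstset x) ?eqxx //.
by apply/setP=> i; rewrite !inE xpair_eqE andbF addbF.
Qed.

Definition layer_dens (i : nat) : R := layer_avg fr i.

Local Notation S g := (\sum_(i < n.+1) 'C(n, i)%:R * g (nat_of_ord i)).

Lemma sum_by_layer (phi : nat -> R) :
  \sum_U fr U * phi #|U| = S (fun i => phi i * layer_dens i).
Proof.
have card_le U : (#|U| < n.+1)%N by rewrite ltnS -[X in (_ <= X)%N]card_ord max_card.
rewrite (partition_big (fun U : {set 'I_n} => inord #|U| : 'I_n.+1) predT) //=.
apply: eq_bigr => i _.
have Ci : 'C(n, i)%:R != 0 :> R by rewrite pnatr_eq0 -lt0n bin_gt0 -ltnS.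
rewrite /layer_dens /layer_avg card_ord mulrCA mulrC [_ * (_ / _)]mulrC divfK //.
rewrite mulr_suml; apply: eq_big => [U|U /eqP <-]; last by rewrite inordK.
by rewrite -val_eqE /= inordK.
Qed.

Lemma layer_dens01 i : (i <= n)%N -> 0 <= layer_dens i <= 1.
Proof.
move=> i_n; have Ci : 0 < 'C(n, i)%:R :> R by rewrite ltr0n bin_gt0.
rewrite /layer_dens /layer_avg card_ord divr_ge0 ?ler0n ?sumr_ge0 //=.
rewrite ler_pdivrMr // mul1r -[X in 'C(X, _)]card_ord -card_draws -sum1_card natr_sum.
rewrite [leRHS]big_mkcond [leLHS]big_mkcond; apply: ler_sum => U _.
by rewrite inE; case: ifP => // _; case: (memA U).
Qed.

(** A random permutation of two nested initial segments couples the two layers. *)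
Lemma layer_dens_mono i j : (i <= j <= n)%N -> layer_dens i <= layer_dens j.
Proof.
move=> /andP[ij jn].
pose first (l : nat) : {set 'I_n} := [set p : 'I_n | (p < l)%N].
have card_first l : (l <= n)%N -> #|first l| = l.
  move=> ln; rewrite -sum1_card (eq_bigl (fun p : 'I_n => (p < l)%N)).
    by rewrite -(big_ord_widen _ (fun _ => 1%N) ln) sum1_card card_ord.
  by move=> p; rewrite inE.
rewrite /layer_dens -(avg_permpre fr (card_first i (leq_trans ij jn))).
rewrite -(avg_permpre fr (card_first j jn)); apply: ler_avg => s.
have sub : permpre s (first i) \subset permpre s (first j).
  by apply: permpreS; apply/subsetP=> p; rewrite !inE => /leq_trans; apply.
have := memA_mono sub.
by case: (memA _); case: (memA _) => //= h; have := h isT.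
Qed.

Lemma alpha_layers :
  layer_avg Fr n = S (fun i => 'C(n, i)%:R * layer_dens i) / 'C(n.*2, n)%:R.
Proof.
rewrite {1}/layer_avg card_pairs (sum_layer_fst fr) -(sum_by_layer (fun i => 'C(n, i)%:R)).
congr (_ / _); apply: eq_bigr => U _.
by have := max_card U; rewrite card_ord => h; rewrite h bin_sub.
Qed.

Lemma beta_layers :
  layer_avg Fr n.+1 = S (fun i => (bin_pred n i)%:R * layer_dens i) / 'C(n.*2, n.+1)%:R.
Proof.
rewrite {1}/layer_avg card_pairs (sum_layer_fst fr) -(sum_by_layer (fun i => (bin_pred n i)%:R)).
congr (_ / _); apply: eq_bigr => U _.
have := max_card U; rewrite card_ord => h; rewrite leqW //; congr (_ * _%:R).
case: #|U| h => [|j] h; first by rewrite subn0 bin_small.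
by rewrite /= subSS bin_sub // ltnW.
Qed.

Lemma jump_layers :
  layer_avg Fr n.+1 - layer_avg Fr n = S (fun i => layer_jump R n i * layer_dens i).
Proof.
rewrite alpha_layers beta_layers !mulr_suml -sumrB; apply: eq_bigr => i _.
by rewrite /layer_jump; ring.
Qed.

Lemma Maj_indpt U : Maj (indpt U) = upper_half R n #|U|.
Proof.
rewrite /Maj /upper_half; congr (nat_of_bool _)%:R.
have -> : \sum_(i < n) (indpt U i)%:R = #|U|%:R :> R.
  rewrite -sum1_card natr_sum [RHS]big_mkcond; apply: eq_bigr => i _.
  by rewrite ffunE; case: (i \in U).
by rewrite ltr_pdivrMr // -natrM ltr_nat muln2.
Qed.

Lemma avg_layers (phi : nat -> R) :
  avg (fun U => fr U * phi #|U|) = S (fun i => phi i * layer_dens i) / 2 ^+ n.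
Proof. by rewrite /avg sum_by_layer card_cube card_ord natrX. Qed.

Lemma cov_layers :
  2 ^+ n * 2 ^+ n * cov (indic R A) Maj =
  2 ^+ n * S (fun i => layer_dens i * upper_half R n i)
  - S layer_dens * S (upper_half R n).
Proof.
have P0 : 2 ^+ n != 0 :> R by rewrite expf_neq0 // pnatr_eq0.
have EfM : expect (fun x => indic R A x * Maj x) =
    S (fun i => layer_dens i * upper_half R n i) / 2 ^+ n.
  rewrite expect_avg (eq_avg (h := fun U => fr U * upper_half R n #|U|)) => [|U].
    rewrite avg_layers; congr (_ / _); apply: eq_bigr => i _.
    by rewrite [upper_half _ _ _ * _]mulrC.
  by rewrite Maj_indpt.
have Ef : expect (indic R A) = S layer_dens / 2 ^+ n.
  rewrite expect_avg (eq_avg (h := fun U => fr U * (fun _ => 1) #|U|)) => [|U].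
    rewrite (avg_layers (fun _ => 1)); congr (_ / _); apply: eq_bigr => i _.
    by rewrite mul1r.
  by rewrite mulr1.
have EM : expect (Maj : Omega n -> R) = S (upper_half R n) / 2 ^+ n.
  rewrite expect_avg (eq_avg Maj_indpt) /avg card_cube card_ord natrX.
  congr (_ / _).
  have card_le U : (#|U| < n.+1)%N by rewrite ltnS -[X in (_ <= X)%N]card_ord max_card.
  rewrite (partition_big (fun U : {set 'I_n} => inord #|U| : 'I_n.+1) predT) //=.
  apply: eq_bigr => i _.
  rewrite (eq_bigr (fun _ => upper_half R n i)) => [|U /eqP <-]; last by rewrite inordK.
  rewrite sumr_const -[_ *+ _]mulr_natl; congr (_%:R * _).
  rewrite -[X in 'C(X, _)]card_ord -card_draws; apply: eq_card => U.
  by rewrite inE unfold_in eqnE /= inordK.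
by rewrite /cov EfM Ef EM; field.
Qed.

End Family.

(** * Conclusion *)

(** With [e] the integer part of the base 3 logarithm of [n] and [d = e %/ 20], one has
    [e + 1 <= 20 * (d + 1)]; the bound [ln 3 <= 2] gives 40. *)
Lemma ln_le_log3 (R : realType) (n : nat) : (0 < n)%N ->
  exists2 d : nat, (3 ^ (20 * d) <= n)%N & ln (n%:R : R) <= 40 * d.+1%:R.
Proof.
move=> n0; pose e := trunc_log 3 n.
have /andP[lo hi] : (3 ^ e <= n < 3 ^ e.+1)%N by apply: trunc_log_bounds.
exists (e %/ 20)%N.
  apply: leq_trans lo; rewrite leq_exp2l // mulnC; exact: leq_trunc_div.
have h : (e.+1 <= 20 * (e %/ 20).+1)%N.
  by rewrite mulnC -[X in (X < _)%N]/e; apply: ltn_ceil.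
have p0 : 0 < n%:R :> R by rewrite ltr0n.
have ln3 : ln (3 : R) <= 2.
  have -> : 3 = 1 + 2 :> R by ring.
  by apply: le_ln1Dx; lra.
have ln3_0 : 0 <= ln (3 : R) by rewrite ln_ge0 // ler1n.
apply: (@le_trans _ _ (ln ((3 : R) ^+ e.+1))).
  by rewrite ler_ln ?posrE ?exprn_gt0 // -natrX ler_nat ltnW.
rewrite lnXn // -[_ *+ _]mulr_natl.
apply: (@le_trans _ _ ((20 * (e %/ 20).+1)%:R * 2)); last by rewrite natrM; lra.
by apply: ler_pM => //; rewrite ?ler0n ?ler_nat.
Qed.

(** Regularity makes all terms of [sum_infl_sqr] equal, so [n] times the squared influence is at
    most 4. *)
Lemma regular_infl_le (R : realType) (n : nat) (A : {set Omega n}) (r : R) k :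
  increasing A -> regular R A -> 0 < r -> r ^+ 2 = n%:R ->
  infl R (memA A) k <= 2 / r.
Proof.
move=> Ainc Areg r0 r2; have I0 := infl_ge0 R (memA A) k.
have := sum_infl_sqr R Ainc.
rewrite (eq_bigr (fun _ => infl R (memA A) k ^+ 2)) => [|j _]; last first.
  by rewrite !infl_influence (Areg j k).
rewrite sumr_const card_ord -[_ *+ _]mulr_natl -r2 -exprMn.
move: (infl R (memA A) k) I0 => I I0 h.
rewrite ler_pdivlMr // mulrC -ler_sqr ?nnegrE ?mulr_ge0 ?(ltW r0) //.
by apply: le_trans h _; rewrite -natrX.
Qed.

Theorem theorem1 (R : realType) :
  exists c : R, 0 < c /\
    forall (n : nat) (A : {set Omega n}),
      (1 <= n)%N -> increasing A -> balanced R A -> regular R A ->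
      cov (indic R A) Maj >= c * (ln n%:R / Num.sqrt n%:R).
Proof.
have ten7 : 0 < 10 ^+ 7 :> R by rewrite exprn_gt0.
(* The argument ends with [40 * (d + 1) <= 40 * 3696 * (64 / 7) * (r * cv)], whose constant is below
   [10 ^+ 7]. *)
exists (10 ^+ 7)^-1; split; first by rewrite invr_gt0.
case=> [//|m] A _ Ainc Abal Areg; set n := m.+1.
have n0 : (0 < n)%N by [].
set r := Num.sqrt n%:R.
have r0 : 0 < r by rewrite sqrtr_gt0 ltr0n.
have r2 : r ^+ 2 = n%:R by rewrite sqr_sqrtr ?ler0n.
set cv := cov _ _; set P : R := 2 ^+ n.
have P0 : 0 < P by rewrite exprn_gt0.
pose a := layer_dens R A.
have a01 : forall i, (i <= n)%N -> 0 <= a i <= 1 by exact: layer_dens01.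
have amono : forall i j, (i <= j <= n)%N -> a i <= a j by exact: layer_dens_mono.
pose D := \sum_(i < n.+1) 'C(n, i)%:R * `|a i - a n./2|.
have D_cov : D <= 4 * (P * cv).
  have := dev_le_cov n0 amono; rewrite -(cov_layers R A) -/P -/cv -/D.
  by rewrite -[P * P * cv]mulrA mulrCA ler_pM2l.
have mean : \sum_(i < n.+1) 'C(n, i)%:R * a i = P / 2.
  have := Abal; rewrite /balanced mu_avg.
  rewrite (eq_avg (h := fun U => (memA A U)%:R * (fun _ => 1) #|U|)) => [|U]; last first.
    by rewrite mulr1.
  rewrite (avg_layers A (fun _ => 1)) => /(congr1 ( *%R^~ P)).
  rewrite divfK ?gt_eqF // mul1r mulrC => <-.
  by apply: eq_bigr => i _; rewrite mul1r.
have D_mean := dev_ge_mean n a; rewrite mean -/P -/D in D_mean.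
have ln_r : ln n%:R / r <= 2.
  rewrite ler_pdivrMr // -r2 lnXn // -[ln r *+ 2]mulr_natl ler_pM2l //.
  exact: ltW (ln_sublinear r0).
have big_cov : 1 / 16 <= cv -> (10 ^+ 7)^-1 * (ln n%:R / r) <= cv.
  move=> h; apply: le_trans h; rewrite mulrC ler_pdivrMr //.
  by apply: le_trans ln_r _; rewrite -natrX; lra.
(* The mean of [a] is 1/2. If the middle density is below 1/4 or above 3/4, then [D >= P / 4], so
   the covariance is at least 1/16 and [ln n / r <= 2] suffices. *)
have [c_lo|c_lo] := ltP (a n./2) (1 / 4).
  apply: big_cov; rewrite -(ler_pM2l P0).
  have := le_trans (ler_norm _) D_mean; have : a n./2 * P <= 1 / 4 * P.
    by rewrite ler_pM2r // ltW.
  lra.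
have [c_hi|c_hi] := ltP (3 / 4) (a n./2).
  apply: big_cov; rewrite -(ler_pM2l P0).
  rewrite -normrN in D_mean; have := le_trans (ler_norm _) D_mean.
  have : 3 / 4 * P <= a n./2 * P by rewrite ler_pM2r // ltW.
  lra.
have C0 : 0 < 'C(n.*2, n)%:R :> R by rewrite ltr0n bin_gt0; lia.
set al := layer_avg (fun x => (ext_memA A x)%:R : R) n.
set be := layer_avg (fun x => (ext_memA A x)%:R : R) n.+1.
have alE : \sum_(i < n.+1) 'C(n, i)%:R * ('C(n, i)%:R * a i) = al * 'C(n.*2, n)%:R.
  by rewrite /al alpha_layers divfK // gt_eqF.
have al_lo : 1 / 8 <= al.
  have := central_avg_lower n0 amono a01; rewrite alE mulrA ler_pM2r //; lra.
have al_hi : al <= 7 / 8.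
  have := central_avg_upper n0 amono a01; rewrite alE.
  rewrite -[X in _ * (X - _)]mul1r -mulrBl mulrA ler_pM2r //; lra.
(* 24 is the 6 of [jump_le_dev] times the 4 of [D_cov]. *)
have jump : r * (be - al) <= 24 * cv.
  have := jump_le_dev n0 a r0 r2; rewrite -(jump_layers R A) -/P -/D -/al -/be.
  rewrite mulrAC ler_pdivlMr // => h.
  by rewrite -(ler_pM2l P0); lra.
have [d d_n ln_d] := ln_le_log3 R n0.
have piv v : \sum_(x : {set 'I_n * bool} | #|x| == n)
    (ext_memA A x != ext_memA A (symd x [set v]))%:R <= 4 / r * 'C(n.*2, n)%:R.
  have -> : 4 / r = 2 * (2 / r) by ring.
  by apply: pivotal_count => // k; apply: regular_infl_le.
have kkl := slice_kkl r0 r2 d_n (ext_memA_mono Ainc) piv.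
rewrite -/al -/be -/n in kkl.
have al2 : 7 / 64 <= al * (1 - al) by nra.
have d0 : 0 < d.+1%:R :> R by rewrite ltr0n.
(* Here [3696 = 154 * 24], and one factor [r] of [n = r ^+ 2] is absorbed by [jump]. *)
have dr : 7 / 64 * d.+1%:R <= 3696 * (r * cv).
  apply: le_trans (_ : al * (1 - al) * d.+1%:R <= _); first by rewrite ler_pM2r.
  apply: le_trans kkl _; rewrite -r2.
  by have := ler_wpM2l (ltW r0) jump; lra.
rewrite mulrA ler_pdivrMr // mulrC ler_pdivrMr //.
apply: le_trans ln_d _; rewrite -natrX; lra.
Qed.
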